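(* Let $\{X_t,t\ge0\}$ be a null-recurrent birth-death process on $\mathbb N=\{0,1,2,\dots\}$ with birth rates $\beta_i>0$ ($i\ge0$) and death rates $\alpha_i>0$ ($i\ge1$), and let $\tau$ be the first returning time to $0$ of the process started at $0$. Let $M(n)$ and $s(n)$ be as defined in the context, let $F(n)=M(n)s(n)$, and let $F^{-1}(x):=\inf\{n\in\mathbb N:F(n)\ge x\}$. Let $w:[0,\infty)\to[0,\infty)$ satisfy Condition (C): $w$ is non-negative and increasing on $[0,\infty)$, and for some $t_0>0$ it is twice differentiable on $[t_0,\infty)$ with $w''(t)<0$ for $t\in[t_0,\infty)$ and $\lim_{t\to\infty}w'(t)=0$. (1) If $\displaystyle\limsup_{n\to\infty}\frac{M(n)}{M(n-1)}<\infty$, then $E(w(\tau))<\infty$ if and only if $\displaystyle\int^\infty|w''(t)|\,M(F^{-1}(t))\,dt<\infty$. (2) If $\displaystyle\limsup_{n\to\infty}\frac{s(n)}{s(n-1)}<\infty$, then $E(w(\tau))<\infty$ if and only if $\displaystyle\int^\infty\frac{t\,|w''(t)|}{s(F^{-1}(t))}\,dt<\infty$.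
   Context: The birth-death process on $\mathbb N$ is the continuous-time Markov chain with conservative $Q$-matrix $q_{i,i+1}=\beta_i$ ($i\ge0$), $q_{i,i-1}=\alpha_i$ ($i\ge1$), $q_{00}=-\beta_0$, $q_{ii}=-(\alpha_i+\beta_i)$ ($i\ge1$), and all other entries $0$. Null recurrent means that, with $\tau=\inf\{t>\eta_1:X_t=0\}$ where $\eta_1$ is the first jump time, one has $P(\tau<\infty\mid X_0=0)=1$ and $E(\tau\mid X_0=0)=\infty$; such a process is non-explosive and uniquely determined by $Q$. $E$ denotes expectation for the process started at $0$. The invariant measure is $m_0=1$, $m_n=\dfrac{\beta_0\beta_1\cdots\beta_{n-1}}{\alpha_1\alpha_2\cdots\alpha_n}$ for $n\ge1$, and $M(n)=\sum_{i=0}^nm_i$. The scale function is $s(0)=0$, $s(1)=\beta_0^{-1}$, $s(n)=\beta_0^{-1}+\sum_{i=1}^{n-1}\dfrac{\alpha_1\cdots\alpha_i}{\beta_0\beta_1\cdots\beta_i}$ for $n\ge2$. $\int^\infty f(t)\,dt<\infty$ means that $\int_k^\infty f(t)\,dt<\infty$ for some (equivalently every) sufficiently large lower limit $k\ge t_0$. *)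

(* Defs.v *)
From HB Require Import structures.
From mathcomp Require Import all_boot all_order all_algebra.
From mathcomp Require Import all_classical all_reals all_analysis.

Set Implicit Arguments.
Unset Strict Implicit.
Unset Printing Implicit Defensive.

Import Order.TTheory GRing.Theory Num.Theory.
Import numFieldNormedType.Exports.

Local Open Scope ring_scope.
Local Open Scope classical_set_scope.

Section continuous_time_chain.
Context (d : measure_display) (T : measurableType d) (R : realType).
Variables (P : probability T R) (X : R -> T -> nat).
(* Only the values [X t] with [0 <= t] are meaningful. *)

(* J_0 = 0 and J_(n+1) = inf {t >= J_n : X_t <> X_(J_n)}, with inf set0 = +oo.
   If J_n = +oo the set is empty, so the junk value [fine +oo] is harmless. *)
Fixpoint jump_time (n : nat) (x : T) : \bar R :=
  if n is k.+1 then
    ereal_inf [set t%:E | t in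
      [set t : R | (jump_time k x <= t%:E)%E
                   /\ X t x <> X (fine (jump_time k x)) x]]
  else 0%E.

Definition jump_chain (n : nat) (x : T) : nat := X (fine (jump_time n x)) x.

Definition holding_time (n : nat) (x : T) : \bar R :=
  (jump_time n.+1 x - jump_time n x)%E.

(* The first time after the first jump at which the process is in state [i]. *)
Definition return_time (i : nat) (x : T) : \bar R :=
  ereal_inf [set t%:E | t in
    [set t : R | (jump_time 1 x < t%:E)%E /\ X t x = i]].

Definition jump_matrix (Q : nat -> nat -> R) (i j : nat) : R :=
  if i == j then 0 else Q i j / - Q i i.

(* Non-explosive continuous-time Markov chain on nat started at [x0] with
   conservative Q-matrix [Q], where [Q i i < 0] for all [i] (no absorbing
   state): a right-continuous process whose jump chain is the discrete-time
   Markov chain with transition matrix [jump_matrix Q], and whose holding times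
   are, conditionally on the jump chain, independent and exponentially
   distributed, the n-th one with parameter [- Q i i], [i] being the n-th state
   of the jump chain. The conditional law is given by its joint survival
   function. *)
Definition markov_chain (Q : nat -> nat -> R) (x0 : nat) : Prop :=
  [/\ forall t, 0 <= t -> measurable_fun setT (X t),
      forall x t, 0 <= t -> \forall s \near t^'+, X s x = X t x,
      {ae P, forall x, jump_time n x @[n --> \oo] --> +oo%E},
      forall (n : nat) (i : nat -> nat),
        P [set x | forall k, (k <= n)%N -> jump_chain k x = i k] =
        ((i 0%N == x0)%:R *
         \prod_(0 <= k < n) jump_matrix Q (i k) (i k.+1))%:E
    & forall (n : nat) (i : nat -> nat) (t : nat -> R),
        (forall k, 0 <= t k) ->
        P [set x | forall k, (k <= n)%N ->
             jump_chain k x = i k /\ ((t k)%:E < holding_time k x)%E] =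
        (P [set x | forall k, (k <= n)%N -> jump_chain k x = i k] *
         (\prod_(0 <= k < n.+1) expR (Q (i k) (i k) * t k))%:E)%E].

(* For the chain started at 0. *)
Definition null_recurrent : Prop :=
  P [set x | (return_time 0 x < +oo)%E] = 1%E
  /\ (\int[P]_x return_time 0 x = +oo)%E.

End continuous_time_chain.

Section birth_death.
Context (R : realType).
Variables (alpha beta : nat -> R).
(* [alpha 0] is never used. *)

Definition bd_Q (i j : nat) : R :=
  if j == i.+1 then beta i
  else if i == j.+1 then alpha i
  else if i == j then (if i is 0%N then - beta 0%N else - (alpha i + beta i))
  else 0.

Definition inv_measure (n : nat) : R :=
  (\prod_(0 <= k < n) beta k) / (\prod_(1 <= k < n.+1) alpha k).

Definition M (n : nat) : R := \sum_(0 <= i < n.+1) inv_measure i.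

Definition scale (n : nat) : R :=
  if n is 0%N then 0
  else (beta 0%N)^-1 +
       \sum_(1 <= i < n) (\prod_(1 <= k < i.+1) alpha k)
                         / (\prod_(0 <= k < i.+1) beta k).

Definition F (n : nat) : R := M n * scale n.

(* inf {n | x <= F n}. The junk value 0 for an empty set is irrelevant for a
   recurrent process, as [scale], hence [F], is then unbounded. *)
Definition F_inv (x : R) : nat :=
  if pselect (exists n, x <= F n) is left h then ex_minn h else 0%N.

End birth_death.

Section condition_C.
Context (R : realType).

Definition condition_C (w : R -> R) (t0 : R) : Prop :=
  [/\ forall t, 0 <= t -> 0 <= w t,
      forall s t, 0 <= s -> s <= t -> w s <= w t,
      0 < t0,
      forall t, t0 <= t ->
        [/\ derivable w t 1, derivable w^`() t 1 & w^`(2) t < 0]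
    & w^`() t @[t --> +oo] --> (0 : R)].

Definition integrable_at_infinity (t0 : R) (f : R -> R) : Prop :=
  exists2 k : R, t0 <= k &
    (\int[lebesgue_measure]_(t in `[k, +oo[) (f t)%:E < +oo)%E.

End condition_C.

(* Main.v *)
(** The truncated mean [H t = E (min tau t)] is comparable to
[M n + t / s n.+1] when [F n < t <= F n.+1], without any growth assumption;
either ratio condition makes one of the two terms dominate, which turns this
into [M (F_inv t)] or [t / s (F_inv t)]. On the other hand
[w x = const + \int_k^oo |w'' t| * min x t dt] for [x >= k] (integrate by parts
twice), so that by Tonelli [E (w tau)] is finite if and only if
[|w''| * H] is integrable at infinity.

To estimate [H], note that [min x t] is comparable to
[t * (1 - exp (- x / t))], so that it suffices to bound the Laplace transform of
[tau]. It is the limit of the weights [hit_laplace] of the paths of the jump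
chain that return to 0 in a bounded number of steps. With [l = 1 / t], let [g i]
be the mean time spent in [[1, n]] before hitting 0 from [i]. Then
[1 - l / (1 + l * F n) * g i] is a nonnegative function [v] such that
[Q v <= l * v] away from 0, and [1 - l * g i - min (s i) (s n.+1) / s n.+1] is a
function [v <= 1] such that [Q v >= l * v]; comparison with the former bounds
the weights from above, and comparison with the latter bounds them from below. *)
Require Import Defs.
From HB Require Import structures.
From mathcomp Require Import all_boot all_order all_algebra.
From mathcomp Require Import all_classical all_reals all_analysis.
From mathcomp Require Import measurable_realfun.
From mathcomp Require Import ring lra.
Import Order.TTheory GRing.Theory Num.Theory.
Import numFieldNormedType.Exports.
Local Open Scope ring_scope.
Local Open Scope classical_set_scope.
Set Implicit Arguments.
Unset Strict Implicit.
Unset Printing Implicit Defensive.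

(** * Integration of an everywhere existing derivative *)

Section cousin.
Context {R : realType}.

(** Integrating by parts is delicate because [w''] is only known to exist and to be negative, not to
    be continuous. Its constant sign is what helps: the increments of an everywhere differentiable
    function with nonnegative derivative equal the Lebesgue integral of that derivative. One
    inequality comes from open covers of level sets, the other from Lusin compacts, and continuous
    induction passes from local to global.

    The Laplace transform replaces the truncated mean because exponential killing leads to a linear
    problem for the generator, where explicit super- and subsolutions give the bounds without
    solving any recursion. Counting jumps turns comparison into an induction; its price is the
    defect [1 - hit_laplace 0 n 1], which vanishes in the limit by recurrence.

    The process is given through its jump chain and the joint survival function of its holding
    times. Expectations are therefore computed on cylinders, one holding time after the other, and
    events in continuous time are reduced to rational times by right-continuity. *)

Lemma cousin (L : R -> R -> Prop) (a b : R) : a <= b ->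
  (forall x y z, a <= x -> x <= y -> y <= z -> z <= b -> L x y -> L y z -> L x z) ->
  (forall x, a <= x <= b -> exists2 d, 0 < d &
     forall y z, a <= y -> x - d < y -> y <= x -> x <= z -> z < x + d -> z <= b ->
       L y z) ->
  L a b.
Proof.
move=> ab Ltrans Lloc.
(* Continuous induction on the points reachable from [a]: the local interval around [c = sup S]
   contains a point of [S], so [c] is reachable, and so are points beyond [c] unless [c = b]. *)
pose S := [set y | a <= y <= b /\ L a y].
have Sa : S a.
  split; first by rewrite lexx.
  have [|e e0 h] := Lloc a; first by rewrite lexx.
  by apply: h => //; lra.
have ubS : ubound S b by move=> y [/andP[]].
have supS : has_sup S by split; [exists a | exists b].
set c := sup S.
have ac : a <= c by apply: ub_le_sup => //; exists b.
have cb : c <= b by apply: ge_sup => //; exists a.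
have [|e e0 he] := Lloc c; first by rewrite ac.
have [y [/andP[ay yb] Lay] cey] := sup_adherent e0 supS.
have yc : y <= c by apply: ub_le_sup; [exists b|split => //; rewrite ay].
have step z : c <= z -> z < c + e -> z <= b -> L a z.
  move=> cz zce zb; apply: (Ltrans a y z) => //; first exact: le_trans cz.
  exact: he.
have [cltb|bc] := ltP c b; last by apply: step => //; lra.
have : S (Num.min b (c + e / 2)).
  split; [rewrite le_min ab/= ge_min lexx/= andbT; lra|apply: step].
  - rewrite le_min cb/=; lra.
  - rewrite gt_min; apply/orP; right; lra.
  - by rewrite ge_min lexx.
move=> /ub_le_sup => /(_ (ex_intro _ b ubS)).
rewrite -/c leNgt lt_min cltb/= => /negP[]; lra.
Qed.

Lemma is_derive_near_line (f : R -> R) (x l e : R) : is_derive x 1 f l -> 0 < e ->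
  exists2 d, 0 < d & forall y, `|y - x| < d -> `|f y - f x - l * (y - x)| <= e * `|y - x|.
Proof.
move=> [df <-] e0.
have /cvgrPdist_le/(_ e e0) := df.
move=> /nbhs_ballP[d/= d0 hd]; exists d => // y yx.
have [->|yx0] := eqVneq y x; first by rewrite !subrr mulr0 subrr normr0 mulr0.
have h0 : y - x != 0 by rewrite subr_eq0.
have := hd (y - x); rewrite /ball/= sub0r normrN => /(_ yx h0).
rewrite /= /GRing.scale/= mulr1 subrK => h.
have -> : f y - f x - 'D_1 f x * (y - x) =
  (- (lim ((fun h : R => h^-1 * (f (h *: (1:R^o) + x) - f x)) @ 0^') - (y - x)^-1 * (f y - f x))) * (y - x).
  by rewrite /derive/GRing.scale/= mulNr mulrBl opprB mulrAC mulVf// mul1r.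
rewrite normrM normrN ler_wpM2r//.
Qed.

End cousin.

Section monotone_FTC.
Context {R : realType}.
Local Notation mu := (@lebesgue_measure R).
Variables (f h : R -> R) (a b : R).
Hypothesis ab : a <= b.
Hypothesis fh : forall x, a <= x <= b -> is_derive x 1 f (h x).
Hypothesis h0 : forall x, a <= x <= b -> 0 <= h x.
Hypothesis mh : measurable_fun `[a, b] h.

(* A countable sum of multiples of indicators of open supersets of the level
   sets of [h] is a lower semicontinuous majorant of [h + e], hence dominates
   the increments of [f] near every point. *)
Lemma increment_le_integral_derivative :
  ((f b - f a)%:E <= \int[mu]_(x in `[a, b]) (h x)%:E)%E.
Proof.
suff H (e : R) : 0 < e -> ((f b - f a)%:E <= \int[mu]_(x in `[a, b]) (h x)%:E +
    (e * (2 * (b - a) + 1))%:E)%E.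
  apply/lee_addgt0Pr => e e0.
  have p0 : 0 < 2 * (b - a) + 1 by rewrite ltr_wpDl// mulr_ge0// subr_ge0.
  by have := H (e / (2 * (b - a) + 1)); rewrite divfK ?gt_eqF//; apply; rewrite divr_gt0.
move=> e0.
pose A k := `[a, b]%classic `&` h @^-1` `[e *+ k, e *+ k.+1[%classic.
have mA k : measurable (A k) by exact: mh.
have finA k : (mu (A k) < +oo)%E.
  apply: (@le_lt_trans _ _ (mu `[a, b]%classic)).
    by apply: le_measure; rewrite ?inE; [exact: mA|exact: measurable_itv|exact: subIsetl].
  by rewrite /= lebesgue_measure_itv/=; case: ifP => _; rewrite ?ltry// -EFinB ltry.
(* The weight on [U k] will be [e *+ k.+2], so an excess measure [dl k] costs [e / 2 ^ k.+1], and
   these costs sum to [e]. The other loss is the integral of [2 * e] over [[a, b]]. *)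
pose dl k : R := (k.+2%:R)^-1 / (2 ^ k.+1)%:R.
have dl0 k : 0 < dl k by rewrite divr_gt0 ?invr_gt0 ?ltr0n// expn_gt0.
have /choice[U HU] : forall k, exists U : set R, [/\ open U, A k `<=` U & (mu (U `\` A k) < (dl k)%:E)%E].
  by move=> k; exact: (lebesgue_regularity_outer (mA k) (finA k) (dl0 k)).
have mU k : measurable (U k) by apply: open_measurable; have [] := HU k.
pose g k (x : R) : \bar R := ((e *+ k.+2) * \1_(U k) x)%:E.
have mg k D : measurable_fun D (g k).
  by apply/measurable_EFinP/measurable_funM => //; exact: measurable_indic.
have g0 k x : (0 <= g k x)%E.
  by rewrite lee_fin mulr_ge0 ?mulrn_wge0// ltW.
pose G x := (\sum_(k <oo) g k x)%E.
have G0 x : (0 <= G x)%E by apply: nneseries_ge0.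
have mG D : measurable_fun D G by apply: ge0_emeasurable_sum.
have key : ((f b - f a)%:E <= \int[mu]_(x in `]a, b]) G x)%E.
  apply: (@cousin R (fun y z => (f z - f y)%:E <= \int[mu]_(x in `]y, z]) G x)%E) => //.
    move=> x y z ax xy yz zb h1 h2.
    have -> : `]x, z]%classic = `]x, y]%classic `|` `]y, z]%classic.
      by apply: itv_bndbnd_setU; rewrite bnd_simp.
    rewrite ge0_integral_setU//.
      have -> : f z - f x = (f y - f x) + (f z - f y) by lra.
      by rewrite EFinD; exact: leeD.
      exact: mG.
    apply/disj_setPS => t /= [].
    rewrite !in_itv/= => /andP[_ ty] /andP[yt _].
    by move: (lt_le_trans yt ty); rewrite ltxx.
  move=> x axb.
  have hx0 := h0 axb.
  pose k := Num.truncn (h x / e).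
  have /andP[kl ku] : (k%:R <= h x / e < k.+1%:R).
    by apply: truncn_itv; rewrite divr_ge0 // ltW.
  have Akx : A k x.
    split; first by rewrite /= in_itv.
    rewrite /= in_itv/= -[e *+ k]mulr_natr -[e *+ k.+1]mulr_natr.
    by rewrite -ler_pdivlMl// -ltr_pdivrMl// mulrC kl.
  (* The height exceeds [h x] by more than [e], which pays for the error of the linear approximation
     of [f] at [x]. *)
  have hk : h x + e < e *+ k.+2.
    have [_ /=] := Akx; rewrite in_itv/= => /andP[_].
    by move=> hk1; rewrite [e *+ k.+2]mulrS; lra.
  have [oU AU _] := HU k.
  have /nbhs_ballP[d1 /= d10 hd1] : nbhs x (U k).
    by apply: open_nbhs_nbhs; split => //; exact: AU.
  have [d2 d20 hd2] := is_derive_near_line (fh axb) e0.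
  exists (Num.min d1 d2); first by rewrite lt_min d10.
  move=> y z ay xdy yx xz zxd zb.
  have dx t : y <= t -> t <= z -> `|t - x| < Num.min d1 d2.
    by move=> yt tz; rewrite ltr_norml; apply/andP; split; lra.
  have yz := le_trans yx xz.
  apply: (@le_trans _ _ (\int[mu]_(x in `]y, z]) (cst (e *+ k.+2)%:E x))%E).
    rewrite integral_cst//= lebesgue_measure_itv/= lte_fin.
    case: ifPn => [yltz|]; last first.
      rewrite -leNgt => zy; have -> : z = y by lra.
      by rewrite subrr mule0.
    rewrite -EFinB -EFinM lee_fin.
    have := dx _ yz (lexx _); have := dx _ (lexx _) yz.
    rewrite !lt_min => /andP[_ /hd2 H2] /andP[_ /hd2 H1].
    move: H1 H2; rewrite (ger0_norm (_ : 0 <= z - x)) ?subr_ge0//.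
    rewrite (ler0_norm (_ : y - x <= 0)) ?subr_le0//.
    rewrite !ler_norml => /andP[_ u1] /andP[u2 _].
    apply: (@le_trans _ _ ((h x + e) * (z - y))); first by nra.
    by rewrite ler_wpM2r ?subr_ge0// ltW.
  apply: ge0_le_integral => //.
  - by move=> t _; rewrite /= lee_fin mulrn_wge0// ltW.
  - exact: mG.
  - move=> t /=; rewrite in_itv/= => /andP[/ltW yt tz].
    apply: (@le_trans _ _ (g k t)); last first.
      rewrite /G (@nneseriesD1 _ _ k)//.
      by rewrite leeDl//; exact: nneseries_ge0.
    rewrite /g indicE mem_set ?mulr1//.
    by apply: hd1; move: (dx t yt tz); rewrite /ball/= lt_min distrC => /andP[].
apply: (le_trans key).
have A_bigcup : `[a, b]%classic = \bigcup_k A k.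
  apply/seteqP; split => [x xab|x [k _ []//]].
  have hx0 : 0 <= h x by apply: h0; move: xab; rewrite /= in_itv.
  exists (Num.truncn (h x / e)) => //; split => //=.
  have /andP[kl ku] : ((Num.truncn (h x / e))%:R <= h x / e < (Num.truncn (h x / e)).+1%:R).
    by apply: truncn_itv; rewrite divr_ge0 // ltW.
  rewrite in_itv/= -(mulr_natr e (Num.truncn (h x / e))).
  rewrite -(mulr_natr e (Num.truncn (h x / e)).+1).
  by rewrite -ler_pdivlMl// -ltr_pdivrMl// (mulrC e^-1) kl.
have trivA : trivIset setT A.
  apply/trivIsetP => i j _ _; wlog ij : i j / (i < j)%N.
    move=> H; rewrite neq_lt => /orP[ij|ji].
      by apply: H => //; rewrite lt_eqF.
    by rewrite setIC; apply: H => //; rewrite lt_eqF.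
  move=> _; apply/seteqP; split => t //= [[_ /=]].
  rewrite in_itv/= => /andP[_ h1] [_ /=]; rewrite in_itv/= => /andP[h2 _].
  have := le_lt_trans h2 h1; rewrite ltr_pMn2l// ltnS.
  by rewrite leqNgt ij.
have mh2 : measurable_fun `[a, b] (fun x => (h x + 2 * e)%:E).
  by apply/measurable_EFinP/measurable_funD.
apply: (@le_trans _ _ (\int[mu]_(x in `[a, b]) (h x + 2 * e)%:E + e%:E)%E); last first.
  under eq_integral do rewrite EFinD.
  rewrite ge0_integralD//; last 2 first.
  - exact/measurable_EFinP.
  - by move=> x _; rewrite lee_fin; lra.
  rewrite integral_cst//= lebesgue_measure_itv/= lte_fin -addeA.
  rewrite leeD2l//; case: ifPn => altb; last by rewrite mule0 add0e lee_fin ler_peMr ?(ltW e0)// lerDr mulr_ge0// subr_ge0.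
  by rewrite -EFinB -EFinM -EFinD lee_fin; lra.
rewrite [X in (_ <= X + _)%E](_ : _ = \sum_(k <oo) \int[mu]_(x in A k) (h x + 2 * e)%:E)%E; last first.
  rewrite {1}A_bigcup ge0_integral_bigcup//; first by rewrite -A_bigcup.
  rewrite -A_bigcup => x /=; rewrite in_itv/= => /h0; rewrite lee_fin; lra.
rewrite integral_nneseries//; last by move=> k; exact: mg.
have Ah0 k : (0 <= \int[mu]_(x in A k) (h x + 2 * e)%:E)%E.
  apply: integral_ge0 => x -[/=]; rewrite in_itv/= => /h0; rewrite lee_fin; lra.
apply: le_trans; last exact: (epsilon_trick predT Ah0 (ltW e0)).
apply: lee_nneseries => [k _ _|k _].
  by apply: integral_ge0 => x _.
apply: (@le_trans _ _ (\int[mu]_x (g k x))%E).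
  by apply: ge0_subset_integral => //; exact: mg.
under eq_integral do rewrite /g EFinM.
rewrite ge0_integralZl//; last 2 first.
  by apply/measurable_EFinP; apply: measurable_indic; exact: mU.
  by rewrite lee_fin mulrn_wge0// ltW.
rewrite integral_indic//; last exact: mU.
rewrite setIT.
have [oU AU UA] := HU k.
have UE : U k = A k `|` (U k `\` A k) by rewrite setDUK.
have ek0 : (0 <= (e *+ k.+2)%:E)%E by rewrite lee_fin mulrn_wge0// ltW.
rewrite [X in (_ * X <= _)%E](_ : _ = mu (A k) + mu (U k `\` A k))%E; last first.
  rewrite {1}UE measureU//; [exact: mA|apply: measurableD; [exact: mU|exact: mA]|exact: setDIK].
rewrite ge0_muleDr//; apply: leeD.
  rewrite -integral_cst//; last exact: mA.
  apply: ge0_le_integral => //.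
  - exact: mA.
  - by apply: measurable_funS mh2 => //; exact: subIsetl.
  - move=> x [_ /=]; rewrite in_itv/= => /andP[hx _].
    by rewrite lee_fin -addn2 mulrnDr -[e *+ 2]mulr_natl; lra.
apply: (@le_trans _ _ ((e *+ k.+2)%:E * (dl k)%:E)%E).
  by apply: lee_wpmul2l; [exact: ek0|exact: ltW].
by rewrite -EFinM lee_fin /dl -(mulr_natr e) mulrA mulfK ?pnatr_eq0.
Qed.

(** Continuity within [K] bounds [h] by [h x + e] at the points of [K] near [x]; if [x] is outside
    the closed set [K], nothing is integrated near [x]. As [f] grows near [x] with slope at least
    [h x - e], continuous induction loses only [2 * e] per unit length. *)
Let integral_derivative_compact_le (K : set R) : compact K -> K `<=` `[a, b] ->
  {within K, continuous h} ->
  (\int[mu]_(x in K) (h x)%:E <= (f b - f a)%:E)%E.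
Proof.
move=> cK Kab hK.
have mK : measurable K by exact: compact_measurable.
have mhS S : measurable S -> measurable_fun (K `&` S) (fun x => (h x)%:E).
  move=> mS; apply/measurable_EFinP; apply: measurable_funS mh => //.
  by move=> x [/Kab].
have h0K x : K x -> (0 <= (h x)%:E)%E.
  by move=> /Kab/=; rewrite in_itv/= => /h0; rewrite lee_fin.
suff H (e : R) : 0 < e ->
    (\int[mu]_(x in K) (h x)%:E <= (f b - f a)%:E + (e * (2 * (b - a) + 1))%:E)%E.
  apply/lee_addgt0Pr => e e0.
  have p0 : 0 < 2 * (b - a) + 1 by rewrite ltr_wpDl// mulr_ge0// subr_ge0.
  by have := H (e / (2 * (b - a) + 1)); rewrite divfK ?gt_eqF//; apply; rewrite divr_gt0.
move=> e0.
have key : (\int[mu]_(x in K `&` `]a, b]) (h x)%:E <= (f b - f a + 2 * e * (b - a))%:E)%E.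
  apply: (@cousin R (fun y z => \int[mu]_(x in K `&` `]y, z]) (h x)%:E <=
    (f z - f y + 2 * e * (z - y))%:E)%E) => //.
    move=> x y z ax xy yz zb h1 h2.
    have -> : K `&` `]x, z] = (K `&` `]x, y]) `|` (K `&` `]y, z]).
      by rewrite -setIUr; congr (_ `&` _); apply: itv_bndbnd_setU; rewrite bnd_simp.
    rewrite ge0_integral_setU//=.
    - have -> : f z - f x + 2 * e * (z - x) =
        (f y - f x + 2 * e * (y - x)) + (f z - f y + 2 * e * (z - y)) by lra.
      by rewrite EFinD; exact: leeD.
    - exact: measurableI.
    - exact: measurableI.
    - by rewrite -setIUr; apply: mhS; exact: measurableU.
    - by move=> t [] [/h0K].
    - apply/disj_setPS => t /= [[_]].
      rewrite !in_itv/= => /andP[_ ty] [_ /andP[yt _]].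
      by move: (lt_le_trans yt ty); rewrite ltxx.
  move=> x axb.
  have hx0 := h0 axb.
  have [d1 d10 hd1] : exists2 d1, 0 < d1 &
      forall t, K t -> `|t - x| < d1 -> h t <= h x + e.
    have [Kx|nKx] := pselect (K x); last first.
      have /nbhs_ballP[d1 /= d10 hd1] : nbhs x (~` K).
        apply: open_nbhs_nbhs; split => //; apply: closed_openC.
        by apply: compact_closed => //; exact: Rhausdorff.
      exists d1 => // t Kt td1; exfalso.
      by apply: (hd1 t) => //; rewrite /ball/= distrC.
    have /subspace_continuousP/(_ x Kx) := hK.
    move=> /cvgrPdist_le/(_ e e0); rewrite near_withinE => /nbhs_ballP[d1 /= d10 hd1].
    exists d1 => // t Kt td1; have := hd1 t; rewrite /ball/= distrC => /(_ td1 Kt).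
    by rewrite ler_norml => /andP[u1 _]; rewrite -lerBlDl -(opprK e) lerNr opprB; exact: u1.
  have [d2 d20 hd2] := is_derive_near_line (fh axb) e0.
  exists (Num.min d1 d2); first by rewrite lt_min d10.
  move=> y z ay xdy yx xz zxd zb.
  have dx t : y <= t -> t <= z -> `|t - x| < Num.min d1 d2.
    by move=> yt tz; rewrite ltr_norml; apply/andP; split; lra.
  have yz := le_trans yx xz.
  apply: (@le_trans _ _ (\int[mu]_(t in `]y, z]) (cst (h x + e)%:E t))%E).
    apply: (@le_trans _ _ (\int[mu]_(t in K `&` `]y, z]) (cst (h x + e)%:E t))%E).
      apply: ge0_le_integral => //.
      - exact: measurableI.
      - by move=> t [/h0K].
      - exact: mhS.
      - move=> t [Kt /=]; rewrite in_itv/= => /andP[/ltW yt tz].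
        by rewrite lee_fin; apply: hd1 => //; have := dx t yt tz; rewrite lt_min => /andP[].
    rewrite !integral_cst//; last exact: measurableI.
    apply: lee_wpmul2l; first by rewrite lee_fin addr_ge0// ltW.
    by apply: le_measure; rewrite ?inE//; exact: measurableI.
  rewrite integral_cst//= lebesgue_measure_itv/= lte_fin.
  case: ifPn => [yltz|]; last first.
    rewrite -leNgt => zy; have -> : z = y by lra.
    by rewrite !subrr mulr0 addr0 mule0.
  rewrite -EFinB -EFinM lee_fin.
  have := dx _ yz (lexx _); have := dx _ (lexx _) yz.
  rewrite !lt_min => /andP[_ /hd2 H2] /andP[_ /hd2 H1].
  move: H1 H2; rewrite (ger0_norm (_ : 0 <= z - x)) ?subr_ge0//.
  rewrite (ler0_norm (_ : y - x <= 0)) ?subr_le0//.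
  by rewrite !ler_norml => /andP[u1 _] /andP[_ u2]; nra.
apply: (@le_trans _ _ (\int[mu]_(x in K `&` `]a, b]) (h x)%:E)%E); last first.
  apply: (le_trans key); rewrite -EFinD lee_fin; lra.
rewrite -(@integral_setD1 _ _ a K)//; last first.
  by apply/measurable_EFinP; apply: measurable_funS mh => // t [/Kab].
  exact: measurableD.
apply: ge0_subset_integral => //.
- exact: measurableD.
- exact: measurableI.
- exact: mhS.
- by move=> t [/h0K].
- move=> t [Kt /= /eqP ta]; split => //.
  have /= := Kab _ Kt; rewrite !in_itv/= => /andP[at_ ->].
  by rewrite andbT lt_neqAle eq_sym ta.
Qed.

(** Where [h] is at most [N], Lusin's theorem leaves out a set of measure below [e / N.+1], which
    contributes at most [e] to the integral. Monotone convergence then removes the truncation at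
    [N]. *)
Lemma integral_derivative_le_increment :
  (\int[mu]_(x in `[a, b]) (h x)%:E <= (f b - f a)%:E)%E.
Proof.
pose D N := `[a, b]%classic `&` h @^-1` `]-oo, N%:R].
have mD N : measurable (D N) by exact: mh.
have DE : `[a, b]%classic = \bigcup_N D N.
  apply/seteqP; split => [x xab|x [k _ []//]].
  exists (Num.bound `|h x|) => //; split => //=.
  by rewrite in_itv/= (le_trans (ler_norm _))// ltW// archi_boundP.
have h0D N x : D N x -> (0 <= (h x)%:E)%E.
  by move=> [/=]; rewrite in_itv/= => /h0; rewrite lee_fin.
have mhD N : measurable_fun (D N) (fun x => (h x)%:E).
  by apply/measurable_EFinP; apply: measurable_funS mh => //; exact: subIsetl.
rewrite DE.
have : (\int[mu]_(x in D N) (h x)%:E)%E @[N --> \oo] --> (\int[mu]_(x in \bigcup_N D N) (h x)%:E)%E.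
  apply: ge0_nondecreasing_set_cvg_integral => //.
  move=> m n mn; apply/subsetPset => x [xab /=]; rewrite in_itv/= => hx.
  by split => //=; rewrite in_itv/= (le_trans hx)// ler_nat.
move=> /cvg_lim <-//; apply: lime_le.
  apply: ereal_nondecreasing_is_cvgn.
  apply: ge0_nondecreasing_set_nondecreasing_integral => //.
  move=> m n mn; apply/subsetPset => x [xab /=]; rewrite in_itv/= => hx.
  by split => //=; rewrite in_itv/= (le_trans hx)// ler_nat.
apply: nearW => N.
apply/lee_addgt0Pr => e e0.
have finD : (mu (D N) < +oo)%E.
  apply: (@le_lt_trans _ _ (mu `[a, b]%classic)).
    by apply: le_measure; rewrite ?inE; [exact: mD|exact: measurable_itv|exact: subIsetl].
  by rewrite /= lebesgue_measure_itv/=; case: ifP => _; rewrite ?ltry// -EFinB ltry.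
have d0 : 0 < e / N.+1%:R by rewrite divr_gt0.
have mhDr : measurable_fun (D N) h by exact/measurable_EFinP.
have [K [cK KD DK hK]] := measurable_almost_continuous (mD N) finD d0 mhDr.
have mK : measurable K by exact: compact_measurable.
have mDK : measurable (D N `\` K) by apply: measurableD => //; exact: mD.
have DNE : D N = K `|` (D N `\` K) by rewrite setDUK.
rewrite {1}DNE ge0_integral_setU//; last 3 first.
- by rewrite -DNE; exact: mhD.
- by rewrite -DNE => x /h0D.
- by apply/disj_setPS => x [? []].
apply: leeD.
  by apply: integral_derivative_compact_le => // x /KD [].
apply: (@le_trans _ _ (\int[mu]_(x in D N `\` K) (cst N%:R%:E x))%E).
  apply: ge0_le_integral => //.
  - by move=> x [/h0D].
  - by apply: measurable_funS (mhD N) => // x [].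
  - by move=> x [[_ /=]]; rewrite in_itv/= lee_fin.
rewrite integral_cst//.
apply: (@le_trans _ _ (N%:R%:E * (e / N.+1%:R)%:E)%E).
  by apply: lee_wpmul2l; [rewrite lee_fin|exact: ltW].
rewrite -EFinM lee_fin mulrA ler_pdivrMr// mulrC ler_pM2l// ler_nat//.
Qed.

Lemma integral_derivative_monotone :
  (\int[mu]_(x in `[a, b]) (h x)%:E = (f b - f a)%:E)%E.
Proof.
apply/eqP; rewrite eq_le integral_derivative_le_increment/=.
exact: increment_le_integral_derivative.
Qed.

End monotone_FTC.

(** * Functions satisfying Condition (C) *)

Section concave_potential.
Context {R : realType}.
Local Notation mu := (@lebesgue_measure R).
Variables (w : R -> R) (t0 : R).
Hypothesis wC : condition_C w t0.
Local Notation w1 := (derive1 w).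
Local Notation w2 := (derive1n 2 w).

Lemma condition_C_gt0 : 0 < t0. Proof. by have [] := wC. Qed.

Lemma condition_C_is_derive1 t : t0 <= t -> is_derive t 1 w (w1 t).
Proof.
move=> t0t; have [_ _ _ /(_ _ t0t)[dw _ _] _] := wC.
by rewrite derive1E; exact: derivableP.
Qed.

Lemma condition_C_is_derive2 t : t0 <= t -> is_derive t 1 w1 (w2 t).
Proof.
move=> t0t; have [_ _ _ /(_ _ t0t)[_ dw _] _] := wC.
by rewrite derive1nS derive1E; exact: derivableP.
Qed.

Lemma condition_C_derive2_lt0 t : t0 <= t -> w2 t < 0.
Proof. by move=> t0t; have [_ _ _ /(_ _ t0t)[]] := wC. Qed.

Lemma measurable_derive1_condition_C : measurable_fun `[t0, +oo[ w1.
Proof.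
apply: subspace_continuous_measurable_fun => //.
apply: derivable_within_continuous => t; rewrite in_itv/= andbT => t0t.
by have [_ _ _ /(_ _ t0t)[]] := wC.
Qed.

(** The second derivative is a pointwise limit of difference quotients of the continuous function
    [w1]; steps to the right stay inside [[t0, +oo[]. *)
Lemma measurable_derive2_condition_C : measurable_fun `[t0, +oo[ w2.
Proof.
pose q n t : R := n.+1%:R * (w1 (t + n.+1%:R^-1) - w1 t).
apply: (@measurable_fun_cvg _ _ _ _ q) => [n|t /=].
  apply: measurable_funM => //; apply: measurable_funB; last exact: measurable_derive1_condition_C.
  apply: (measurable_comp (F := `[t0, +oo[)) => //.
  - move=> _ [t /= + <-]; rewrite !in_itv/= !andbT => t0t.
    by rewrite (le_trans t0t)// lerDl.
  - exact: measurable_derive1_condition_C.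
  - by apply: measurable_funD.
rewrite in_itv/= andbT => t0t.
apply/cvgrPdist_le => e e0.
have [d d0 hd] := is_derive_near_line (condition_C_is_derive2 t0t) e0.
near=> n.
have n1 : n.+1%:R^-1 < d by near: n; exact: near_infty_natSinv_lt (PosNum d0).
have n0 : 0 < n.+1%:R^-1 :> R by rewrite invr_gt0.
have := hd (t + n.+1%:R^-1); rewrite addrAC subrr add0r gtr0_norm// => /(_ n1) h.
have nN0 : n.+1%:R != 0 :> R by rewrite pnatr_eq0.
have -> : w2 t - q n t =
    - n.+1%:R * (w1 (t + n.+1%:R^-1) - w1 t - w2 t * n.+1%:R^-1).
  by rewrite /q; field.
by rewrite normrM normrN normr_nat -ler_pdivlMl ?ltr0n// (mulrC _ e).
Unshelve. all: by end_near. Qed.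

Lemma integral_derive2_itv x y : t0 <= x -> x <= y ->
  (\int[mu]_(t in `[x, y]) `|w2 t|%:E = (w1 x - w1 y)%:E)%E.
Proof.
move=> t0x xy.
under eq_integral => t.
  rewrite inE/= in_itv/= => /andP[xt _].
  rewrite ltr0_norm; last exact/condition_C_derive2_lt0/(le_trans t0x).
  over.
have dw1 t : x <= t <= y -> is_derive t 1 (fun t => - w1 t) (- w2 t).
  move=> /andP[xt _]; apply: is_deriveN.
  exact/condition_C_is_derive2/(le_trans t0x).
have w2le0 t : x <= t <= y -> 0 <= - w2 t.
  move=> /andP[xt _]; rewrite oppr_ge0 ltW//.
  exact/condition_C_derive2_lt0/(le_trans t0x).
have mw2 : measurable_fun `[x, y] (fun t => - w2 t).
  apply: measurable_funN; apply: measurable_funS measurable_derive2_condition_C => //.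
  by move=> t /=; rewrite !in_itv/= andbT => /andP[/(le_trans t0x)].
rewrite (@integral_derivative_monotone R _ _ _ _ xy dw1 w2le0 mw2).
by rewrite opprK addrC.
Qed.

Lemma integral_mul_derive2_itv x y : t0 <= x -> x <= y ->
  (\int[mu]_(t in `[x, y]) (`|w2 t| * t)%:E =
   (w y - y * w1 y - (w x - x * w1 x))%:E)%E.
Proof.
move=> t0x xy; have t00 := condition_C_gt0.
under eq_integral => t.
  rewrite inE/= in_itv/= => /andP[xt _].
  rewrite ltr0_norm; last exact/condition_C_derive2_lt0/(le_trans t0x).
  over.
(* Integration by parts in differential form: the boundary term [w t - t * w1 t] is an
   antiderivative of [- w2 t * t], which has constant sign. *)
have df t : x <= t <= y -> is_derive t 1 (fun t => w t - t * w1 t) (- w2 t * t).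
  move=> /andP[xt _].
  have d1 := condition_C_is_derive1 (le_trans t0x xt).
  have d2 := condition_C_is_derive2 (le_trans t0x xt).
  apply: is_derive_eq.
  by rewrite /GRing.scale/=; ring.
have w2le0 t : x <= t <= y -> 0 <= - w2 t * t.
  move=> /andP[xt _]; rewrite mulr_ge0//.
    by rewrite oppr_ge0 ltW//; exact/condition_C_derive2_lt0/(le_trans t0x).
  by rewrite (le_trans (ltW t00))// (le_trans t0x).
have mw2 : measurable_fun `[x, y] (fun t => - w2 t * t).
  apply: measurable_funM => //.
  apply: measurable_funN; apply: measurable_funS measurable_derive2_condition_C => //.
  by move=> t /=; rewrite !in_itv/= andbT => /andP[/(le_trans t0x)].
by rewrite (@integral_derivative_monotone R _ _ _ _ xy df w2le0 mw2).
Qed.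

Lemma measurable_abs_derive2_condition_C k D : t0 <= k -> measurable D -> D `<=` `[k, +oo[ ->
  measurable_fun D (fun t => `|w2 t|).
Proof.
move=> t0k mD Dk; apply: measurableT_comp => //.
apply: measurable_funS measurable_derive2_condition_C => // t /Dk/=.
by rewrite !in_itv/= !andbT => /(le_trans t0k).
Qed.

Lemma integral_derive2_infty x : t0 <= x ->
  (\int[mu]_(t in `[x, +oo[) `|w2 t|%:E = (w1 x)%:E)%E.
Proof.
move=> t0x.
have E : `[x, +oo[%classic = \bigcup_n `[x, x + n%:R]%classic.
  apply/seteqP; split => t /=; rewrite ?in_itv/= ?andbT.
    move=> xt; exists (Num.bound `|t - x|) => //=.
    rewrite in_itv/= xt/= -lerBlDl (le_trans (ler_norm _))// ltW//.
    exact/archi_boundP.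
  by move=> [n _ /=]; rewrite in_itv/= => /andP[].
have sub n : `[x, x + n%:R] `<=` `[x, +oo[.
  by move=> t /=; rewrite !in_itv/= andbT => /andP[].
have : (\int[mu]_(t in `[x, (x + n%:R)%R]) `|w2 t|%:E)%E @[n --> \oo] -->
    (\int[mu]_(t in \bigcup_n `[x, (x + n%:R)%R]%classic) `|w2 t|%:E)%E.
  apply: ge0_nondecreasing_set_cvg_integral => //.
  - move=> m n mn; apply/subsetPset => t /=; rewrite !in_itv/= => /andP[-> h]/=.
    by rewrite (le_trans h)// lerD2l ler_nat.
  - by move=> n; apply/measurable_EFinP; exact: (measurable_abs_derive2_condition_C t0x).
rewrite E => /cvg_lim <-//; apply/cvg_lim => //.
under eq_fun do rewrite integral_derive2_itv// ?lerDl//.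
apply: cvg_EFin; first by apply: nearW.
rewrite -[X in _ --> X]subr0; apply: cvgB; first exact: cvg_cst.
have [_ _ _ _ w'0] := wC.
apply: (cvg_comp _ _ _ w'0).
apply/cvgryPge => A; near=> n.
rewrite -lerBlDl; near: n; exact: nbhs_infty_ger.
Unshelve. all: by end_near. Qed.

Lemma derive1_condition_C_ge0 x : t0 <= x -> 0 <= w1 x.
Proof.
move=> /integral_derive2_infty h; rewrite -lee_fin -h.
by apply: integral_ge0.
Qed.

End concave_potential.

Section truncated_moments.
Context {R : realType}.
Local Notation mu := (@lebesgue_measure R).
Variables (w : R -> R) (t0 : R).
Hypothesis wC : condition_C w t0.
Local Notation w1 := (derive1 w).
Local Notation w2 := (derive1n 2 w).

Lemma integral_derive2_min_ge k x : t0 <= k -> k <= x ->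
  (\int[mu]_(t in `[k, +oo[) (`|w2 t| * Num.min x t)%:E =
   (w x - w k + k * w1 k)%:E)%E.
Proof.
move=> t0k kx; have t0x := le_trans t0k kx; have t00 := condition_C_gt0 wC.
have -> : `[k, +oo[%classic = `[k, x]%classic `|` `]x, +oo[%classic.
  by apply: itv_bndbnd_setU; rewrite bnd_simp.
have msub D : measurable D -> D `<=` `[k, +oo[ -> measurable_fun D (fun t => (`|w2 t| * Num.min x t)%:E).
  move=> mD Dk; apply/measurable_EFinP; apply: measurable_funM.
    exact: (measurable_abs_derive2_condition_C wC t0k).
  exact: measurable_minr.
have sub : `[k, x] `|` `]x, +oo[ `<=` `[k, +oo[.
  move=> t [] /=; rewrite !in_itv/= !andbT; first by move=> /andP[].
  by move=> /ltW; exact: le_trans.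
rewrite ge0_integral_setU//; last 3 first.
- by apply: msub => //; exact: measurableU.
- move=> t /sub/=; rewrite in_itv/= andbT => kt.
  by rewrite lee_fin mulr_ge0// le_min !(le_trans (ltW t00))//; exact: le_trans kt.
- apply/disj_setPS => t []/=; rewrite !in_itv/= andbT => /andP[_ tx] xt.
  by move: (lt_le_trans xt tx); rewrite ltxx.
have -> : (\int[mu]_(t in `[k, x]) (`|w2 t| * Num.min x t)%:E =
           \int[mu]_(t in `[k, x]) (`|w2 t| * t)%:E)%E.
  apply: eq_integral => t; rewrite inE/= in_itv/= => /andP[_ tx].
  by rewrite min_r.
have -> : (\int[mu]_(t in `]x, +oo[) (`|w2 t| * Num.min x t)%:E =
           \int[mu]_(t in `]x, +oo[) (x%:E * `|w2 t|%:E))%E.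
  apply: eq_integral => t; rewrite inE/= in_itv/= andbT => xt.
  by rewrite min_l ?(ltW xt)// mulrC EFinM.
have mx : measurable_fun `]x, +oo[ (fun t => `|w2 t|%:E).
  apply/measurable_EFinP; apply: (measurable_abs_derive2_condition_C wC t0k) => //.
  by move=> t xt; apply: sub; right.
rewrite ge0_integralZl//; last by rewrite lee_fin (le_trans (ltW t00)).
rewrite integral_itv_obnd_cbnd// (integral_derive2_infty wC)// (integral_mul_derive2_itv wC)//.
by rewrite -EFinM -EFinD; congr EFin; ring.
Qed.

Lemma integral_derive2_min_le k x : t0 <= k -> 0 <= x <= k ->
  (\int[mu]_(t in `[k, +oo[) (`|w2 t| * Num.min x t)%:E = (x * w1 k)%:E)%E.
Proof.
move=> t0k /andP[x0 xk].
under eq_integral => t.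
  rewrite inE/= in_itv/= andbT => kt.
  rewrite min_l ?(le_trans xk)// mulrC EFinM.
  over.
rewrite ge0_integralZl//.
  by rewrite (integral_derive2_infty wC).
by apply/measurable_EFinP; apply: (measurable_abs_derive2_condition_C wC t0k).
Qed.

Lemma condition_C_expectation d (T : measurableType d) (P : probability T R)
    (Y : T -> R) k : measurable_fun setT Y -> (forall x, 0 <= Y x) -> t0 <= k ->
  ('E_P[fun x => w (Y x)] < +oo)%E <->
  (\int[mu]_(t in `[k, +oo[) (`|w2 t|%:E * \int[P]_x (Num.min (Y x) t)%:E) < +oo)%E.
Proof.
move=> mY Y0 t0k; have t00 := condition_C_gt0 wC.
have k0 : 0 < k by exact: lt_le_trans t0k.
have w1k := derive1_condition_C_ge0 wC t0k.
have [w0 wmono _ _ _] := wC.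
(* Closed form of the integral of [|w2 t| * min y t] over [[k, +oo[]. It exceeds [w y] by at most
   [k * w1 k] and falls below it by at most [w k], so on a probability space the two expectations
   are finite together. *)
pose K y := if k <= y then w y - w k + k * w1 k else y * w1 k.
have KE (y : R) : 0 <= y -> (\int[mu]_(t in `[k, +oo[) (`|w2 t| * Num.min y t)%:E = (K y)%:E)%E.
  move=> y0; rewrite /K; case: leP => ky; first exact: integral_derive2_min_ge.
  by apply: integral_derive2_min_le => //; rewrite y0 ltW.
have K0 (y : R) : 0 <= y -> 0 <= K y.
  move=> y0; rewrite -lee_fin -KE//; apply: integral_ge0 => t /=.
  rewrite in_itv/= andbT => kt.
  by rewrite lee_fin mulr_ge0// le_min y0 (le_trans (ltW k0)).
pose G (z : T * R) : \bar R := (\1_(`[k, +oo[%classic) z.2 * `|w2 z.2| * Num.min (Y z.1) z.2)%:E.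
have G0 z : (0 <= G z)%E.
  rewrite /G indicE; case: (boolP (z.2 \in _)) => [|_]; last by rewrite !mul0r.
  rewrite inE/= in_itv/= andbT => kz.
  by rewrite mul1r lee_fin mulr_ge0// le_min Y0 (le_trans (ltW k0)).
have mG : measurable_fun setT G.
  apply/measurable_EFinP; apply: measurable_funM; last first.
    apply: measurable_minr => //.
    exact: measurableT_comp.
  have -> : (fun z : T * R => \1_`[k, +oo[ z.2 * `|w2 z.2|) =
      ((fun t => `|w2 t|) \_ `[k, +oo[) \o snd.
    apply/funext => z /=; rewrite patchE indicE; case: (boolP (z.2 \in _)) => _; by rewrite ?mul1r ?mul0r.
  apply: measurableT_comp => //.
  apply/(measurable_restrictT _ (measurable_itv _)).
  exact: (measurable_abs_derive2_condition_C wC t0k).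
have tonelli : (\int[mu]_(t in `[k, +oo[) (`|w2 t|%:E * \int[P]_x (Num.min (Y x) t)%:E) =
   \int[P]_x (K (Y x))%:E)%E.
  transitivity (\int[mu]_t \int[P]_x G (x, t))%E.
    rewrite integral_mkcond; apply: eq_integral => t _.
    rewrite patchE; case: ifPn => [|tk]; last first.
      rewrite integral0_eq// => x _.
      by rewrite /G/= indicE (negbTE tk) !mul0r.
    move=> tk; rewrite -ge0_integralZl//; last 2 first.
    - by apply/measurable_EFinP; exact: measurable_minr.
    - move: tk; rewrite inE/= in_itv/= andbT => kt x _.
      by rewrite lee_fin le_min Y0 (le_trans (ltW k0)).
    by apply: eq_integral => x _; rewrite /G/= indicE tk mul1r EFinM.
  rewrite -(fubini_tonelli (m1 := P) (m2 := mu) G mG G0); apply: eq_integral => x _.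
  rewrite -KE// [in RHS]integral_mkcond; apply: eq_integral => t _.
  by rewrite patchE /G/= indicE; case: (boolP (t \in _)) => _; rewrite ?mul1r ?mul0r.
rewrite tonelli.
(* Measurability of [K (Y x)] is read off from its representation as a partial integral of the
   jointly measurable [G]. *)
have mKY : measurable_fun setT (fun x => (K (Y x))%:E).
  have := measurable_fun_fubini_tonelli_F (m2 := mu) G mG G0.
  congr measurable_fun; apply/funext => x; rewrite /fubini_F -KE// [RHS]integral_mkcond.
  apply: eq_integral => t _.
  by rewrite patchE /G/= indicE; case: (boolP (t \in _)) => _; rewrite ?mul1r ?mul0r.
have mwY : measurable_fun setT (fun x => (w (Y x))%:E).
  apply/measurable_EFinP.
  (* Since [w] is monotone on [[0, +oo[] only, clipping at 0 produces a function monotone on the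
     whole line. *)
  have -> : (fun x => w (Y x)) = (fun y => w (Num.max 0 y)) \o Y.
    by apply/funext => x /=; rewrite max_r.
  apply: measurableT_comp => //.
  apply: nondecreasing_measurable => // s t st; apply: wmono; first by rewrite le_max lexx.
  by rewrite ge_max !le_max lexx st/= orbT.
have add_cst (f g : T -> R) (c : R) : measurable_fun setT (EFin \o f) ->
    measurable_fun setT (EFin \o g) ->
    (forall x, 0 <= f x) -> (forall x, 0 <= g x) -> 0 <= c -> (forall x, f x <= g x + c) ->
    (\int[P]_x (g x)%:E < +oo -> \int[P]_x (f x)%:E < +oo)%E.
  move=> mf mg f0 g0 c0 fg goo.
  apply: (@le_lt_trans _ _ (\int[P]_x ((g x)%:E + cst c%:E x))%E).
    apply: ge0_le_integral => //.
    - by move=> x _; rewrite lee_fin.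
    - by apply: emeasurable_funD.
    - by move=> x _; rewrite /= -EFinD lee_fin.
  rewrite ge0_integralD//; last by move=> x _; rewrite lee_fin.
  rewrite integral_cst//= probability_setT mule1.
  by rewrite lte_add_pinfty// ltry.
have K0Y x : 0 <= K (Y x) by exact: K0.
have w0Y x : 0 <= w (Y x) by exact: w0.
have kw1 : 0 <= k * w1 k by rewrite mulr_ge0// ltW.
rewrite unlock; split.
- apply: (add_cst (K \o Y) (w \o Y) (k * w1 k)) => //= x.
  rewrite /K/=; case: (leP k (Y x)) => ky; first by rewrite lerD2r gerBl w0// ltW.
  by rewrite ler_wpDl// ler_wpM2r// ltW.
- apply: (add_cst (w \o Y) (K \o Y) (w k)) => //=; first by rewrite w0// ltW.
  move=> x; rewrite /K/=; case: (leP k (Y x)) => ky; first by rewrite addrAC subrK lerDl.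
  by rewrite ler_wpDl ?mulr_ge0//; apply: wmono => //; exact: ltW.
Qed.

End truncated_moments.

(** * Potential theory of the birth-death generator *)

Section birth_death_potential.
Context {R : realType}.
Variables (alpha beta : nat -> R).
Hypothesis alpha_gt0 : forall i, (1 <= i)%N -> 0 < alpha i.
Hypothesis beta_gt0 : forall i, 0 < beta i.
Local Notation m := (inv_measure alpha beta).
Local Notation M := (M alpha beta).
Local Notation s := (scale alpha beta).
Local Notation F := (F alpha beta).

(* [E_i (exp (- l * sigma); N <= n)], where [sigma] is the hitting time of 0
   and [N] the number of jumps it takes to reach 0. *)
Fixpoint hit_laplace (l : R) (n i : nat) : R :=
  if i is j.+1 then
    if n is n'.+1 then
      (beta i * hit_laplace l n' i.+1 + alpha i * hit_laplace l n' j) /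
      (alpha i + beta i + l)
    else 0
  else 1.

Lemma hit_laplace0 l n : hit_laplace l n 0 = 1. Proof. by case: n. Qed.

Lemma hit_laplaceS l n i : hit_laplace l n.+1 i.+1 =
  (beta i.+1 * hit_laplace l n i.+2 + alpha i.+1 * hit_laplace l n i) /
  (alpha i.+1 + beta i.+1 + l).
Proof. by []. Qed.

Let a0 i : 0 < alpha i.+1. Proof. exact: alpha_gt0. Qed.

Let q_gt0 (l : R) i : 0 <= l -> 0 < alpha i.+1 + beta i.+1 + l.
Proof. by move=> l0; have := a0 i; have := beta_gt0 i.+1; lra. Qed.

(** Comparison by induction on the number of jumps. With no jump left the weight is 0 off the
    origin, so nonnegativity of [v] takes the place of a boundary condition at infinity. *)
Lemma hit_laplace_le_super l n i (v : nat -> R) : 0 <= l ->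
  (forall j, 0 <= v j) -> v 0%N = 1 ->
  (forall j, beta j.+1 * v j.+2 + alpha j.+1 * v j <=
             (alpha j.+1 + beta j.+1 + l) * v j.+1) ->
  hit_laplace l n i <= v i.
Proof.
move=> l0 v0 v01 vsup; elim: n i => [|n IH] [|i]; rewrite ?hit_laplace0 ?v01//.
rewrite hit_laplaceS ler_pdivrMr ?q_gt0// (mulrC (v _)).
apply: le_trans (vsup i); apply: lerD; rewrite ler_pM2l//.
Qed.

Lemma hit_laplace_le1 l n i : 0 <= l -> hit_laplace l n i <= 1.
Proof.
move=> l0; apply: (@hit_laplace_le_super _ _ _ (fun=> 1)) => // j.
by have := a0 j; have := beta_gt0 j.+1; lra.
Qed.

(* [1 - hit_laplace 0 n i] bounds the weight of the paths that need more than
   [n] jumps to reach 0. *)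
Lemma hit_laplace_ge_sub l n i (v : nat -> R) : 0 <= l ->
  (forall j, v j <= 1) -> v 0%N = 1 ->
  (forall j, (alpha j.+1 + beta j.+1 + l) * v j.+1 <=
             beta j.+1 * v j.+2 + alpha j.+1 * v j) ->
  v i <= hit_laplace l n i + (1 - hit_laplace 0 n i).
Proof.
move=> l0 v1 v01 vsub; elim: n i => [|n IH] [|i].
- by rewrite !hit_laplace0 v01 subrr addr0.
- by rewrite /= subr0 add0r.
- by rewrite !hit_laplace0 v01 subrr addr0.
have a := a0 i; have b := beta_gt0 i.+1.
rewrite !hit_laplaceS.
have ql := q_gt0 i l0; have q0 := q_gt0 i (lexx 0).
set A := hit_laplace l n i.+2; set B := hit_laplace l n i.
set C := hit_laplace 0 n i.+2; set D := hit_laplace 0 n i.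
have hA : v i.+2 <= A + (1 - C) := IH i.+2.
have hB : v i <= B + (1 - D) := IH i.
have hC : 0 <= 1 - C by rewrite subr_ge0; exact: hit_laplace_le1.
have hD : 0 <= 1 - D by rewrite subr_ge0; exact: hit_laplace_le1.
have -> : 1 - (beta i.+1 * C + alpha i.+1 * D) / (alpha i.+1 + beta i.+1 + 0) =
    (beta i.+1 * (1 - C) + alpha i.+1 * (1 - D)) / (alpha i.+1 + beta i.+1 + 0).
  by rewrite -[X in X - _](divff (lt0r_neq0 q0)) -mulrBl; congr (_ / _); ring.
apply: (@le_trans _ _ ((beta i.+1 * A + alpha i.+1 * B) / (alpha i.+1 + beta i.+1 + l) +
   (beta i.+1 * (1 - C) + alpha i.+1 * (1 - D)) / (alpha i.+1 + beta i.+1 + l))).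
  rewrite -mulrDl ler_pdivlMr// mulrC (le_trans (vsub i))//.
  have := ler_wpM2l (ltW b) hA; have := ler_wpM2l (ltW a) hB; lra.
(* Removing [l] from the denominator only enlarges the defect term, because [1 - C] and [1 - D] are
   nonnegative. *)
rewrite lerD2l ler_wpM2l//; last by rewrite lef_pV2 ?posrE; lra.
by rewrite addr_ge0// mulr_ge0// ltW.
Qed.

Lemma inv_measure_gt0 n : 0 < m n.
Proof.
rewrite /inv_measure divr_gt0//; first by apply: prodr_gt0 => i _.
rewrite big_add1 /=; apply: prodr_gt0 => i _; exact: a0.
Qed.

(** Detailed balance. It gives the scale increment a form with [beta n] and one with [alpha n.+1],
    so that both terms of the generator simplify. *)
Lemma inv_measureS n : m n.+1 * alpha n.+1 = m n * beta n.
Proof.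
rewrite /inv_measure big_nat_recr//= (big_nat_recr n.+1 1)//=.
have P0 : \prod_(1 <= k < n.+1) alpha k != 0.
  by rewrite gt_eqF// big_add1/=; apply: prodr_gt0 => i _; exact: a0.
by field; rewrite P0 gt_eqF.
Qed.

Lemma scaleS n : s n.+1 - s n = (m n * beta n)^-1.
Proof.
case: n => [|n].
  by rewrite /scale/= big_geq// addr0 subr0 /inv_measure !big_geq// divr1 mul1r.
rewrite /scale big_nat_recr//= [_ + (_ + _)]addrA [X in X - _]addrC addrK.
rewrite /inv_measure (big_nat_recr n.+1 0)//=.
by rewrite [in LHS]invfM mulrA invfM invf_div.
Qed.

Lemma scaleSa n : s n.+1 - s n = (m n.+1 * alpha n.+1)^-1.
Proof. by rewrite inv_measureS scaleS. Qed.

Lemma scale_lt n : s n < s n.+1.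
Proof. by rewrite -subr_gt0 scaleS invr_gt0 mulr_gt0// inv_measure_gt0. Qed.

Lemma scale_le i j : (i <= j)%N -> s i <= s j.
Proof.
apply: (homo_leq (f := s) (r := fun x y => x <= y)) => //; first exact: le_trans.
by move=> k; exact/ltW/scale_lt.
Qed.

Lemma scale_gt0 n : 0 < s n.+1.
Proof. by apply: lt_le_trans (scale_le (ltn0Sn n)); exact: (scale_lt 0). Qed.

Lemma scale_ge0 n : 0 <= s n.
Proof. exact: (scale_le (leq0n n)). Qed.

Lemma scale1 : s 1 = (beta 0)^-1.
Proof. by rewrite /scale big_geq// addr0. Qed.

Lemma MS n : M n.+1 = M n + m n.+1.
Proof. by rewrite /Defs.M big_nat_recr. Qed.

Lemma M_zero : M 0 = 1.
Proof. by rewrite /Defs.M big_nat1 /inv_measure !big_geq// divr1. Qed.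

Lemma M_le i j : (i <= j)%N -> M i <= M j.
Proof.
apply: (homo_leq (f := M) (r := fun x y => x <= y)) => //; first exact: le_trans.
by move=> k; rewrite MS lerDl; exact/ltW/inv_measure_gt0.
Qed.

Lemma M_ge1 n : 1 <= M n.
Proof. by rewrite -M_zero; exact: M_le. Qed.

Lemma M_gt0 n : 0 < M n. Proof. exact: lt_le_trans (M_ge1 n). Qed.

(* The expected time spent in [1, n] before hitting 0 from [i], that is
   [\sum_(1 <= j <= n) m j * min (s i) (s j)]. *)
Definition occupation (n i : nat) : R :=
  \sum_(k < i) (s k.+1 - s k) * (M n - M (minn k n)).

Lemma occupationS n i : occupation n i.+1 =
  occupation n i + (s i.+1 - s i) * (M n - M (minn i n)).
Proof. by rewrite /occupation big_ord_recr. Qed.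

Lemma occupation1 n : occupation n 1 = (M n - 1) / beta 0.
Proof.
rewrite /occupation big_ord1 scaleS (_ : minn _ _ = 0%N) ?min0n// M_zero.
by rewrite /inv_measure !big_geq// divr1 mul1r mulrC.
Qed.

Let Mmin_ge0 n i : 0 <= M n - M (minn i n).
Proof. by rewrite subr_ge0 M_le// geq_minr. Qed.

Lemma occupation_ge0 n i : 0 <= occupation n i.
Proof.
apply: sumr_ge0 => k _; rewrite mulr_ge0// subr_ge0; exact/ltW/scale_lt.
Qed.

Lemma occupation_le n i : occupation n i <= F n.
Proof.
(* The increments of the occupation vanish from [n] on, so the induction has to stop the scale at
   [minn i n]; each earlier increment carries a factor at most [M n]. *)
suff H : occupation n i <= s (minn i n) * M n.
  apply: (le_trans H); rewrite /Defs.F mulrC ler_pM2l ?M_gt0//.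
  by apply: scale_le; exact: geq_minr.
elim: i => [|i IH].
  by rewrite /occupation big_ord0 min0n mul0r.
rewrite occupationS; have [ni|lin] := leqP n i.
  rewrite ?(minn_idPr ni) subrr mulr0 addr0.
  by move: IH; rewrite (minn_idPr (leqW ni)) (minn_idPr ni).
rewrite ?(minn_idPl lin) ?(minn_idPl (ltnW lin)); move: IH; rewrite (minn_idPl (ltnW lin)) => IH.
have := scale_lt i; have := M_gt0 i => Mi si.
have : (s i.+1 - s i) * (M n - M i) <= (s i.+1 - s i) * M n.
  by rewrite ler_wpM2l// ?subr_ge0 ?(ltW si)//; lra.
by move: IH; lra.
Qed.

(** Poisson equation at state [i.+1], where [i < n] expresses that this state lies in [[1, n]]. The
    rates cancel against the scale increments, leaving a difference of consecutive values of [M]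
    divided by [m i.+1]. *)
Lemma occupation_generator n i :
  beta i.+1 * (occupation n i.+2 - occupation n i.+1) -
  alpha i.+1 * (occupation n i.+1 - occupation n i) = - (i < n)%:R.
Proof.
have inc j : occupation n j.+1 - occupation n j = (s j.+1 - s j) * (M n - M (minn j n)).
  by rewrite occupationS addrAC subrr add0r.
rewrite !inc (scaleS i.+1) (scaleSa i).
have b := beta_gt0 i.+1; have a := a0 i; have mi := inv_measure_gt0 i.+1.
have -> : beta i.+1 * ((m i.+1 * beta i.+1)^-1 * (M n - M (minn i.+1 n))) -
   alpha i.+1 * ((m i.+1 * alpha i.+1)^-1 * (M n - M (minn i n))) =
   (M (minn i n) - M (minn i.+1 n)) / m i.+1.
  by field; rewrite !gt_eqF.
have [lin|ni] := ltnP i n.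
  rewrite ?(minn_idPl lin) ?(minn_idPl (ltnW lin)) MS /=.
  by field; rewrite gt_eqF.
by rewrite ?(minn_idPr ni) (minn_idPr (leqW ni)) subrr mul0r oppr0.
Qed.

Lemma hit_laplace_upper l k n : 0 < l ->
  hit_laplace l k 1 <= 1 - l / (1 + l * F n) * ((M n - 1) / beta 0).
Proof.
move=> l0; rewrite -occupation1.
have Fn0 : 0 <= F n by rewrite mulr_ge0 ?scale_ge0// ltW// M_gt0.
have den : 0 < 1 + l * F n by rewrite ltr_wpDr// mulr_ge0// ltW.
(* The largest [e] with [e <= l * (1 - e * F n)]. As the occupation is at most [F n], this
   inequality yields both the nonnegativity of [1 - e * occupation n i] and the supersolution
   property. *)
set e := l / _; have e0 : 0 < e by rewrite divr_gt0.
have eE : e * (1 + l * F n) = l by rewrite divfK// gt_eqF.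
have v_ge i : e <= l * (1 - e * occupation n i).
  have h : e * (l * occupation n i) <= e * (l * F n).
    by rewrite ler_pM2l// ler_pM2l// occupation_le.
  by have := eE; lra.
apply: (@hit_laplace_le_super _ _ _ (fun i => 1 - e * occupation n i)).
- exact: ltW.
- by move=> i; rewrite -(pmulr_rge0 _ l0) (le_trans (ltW e0)).
- by rewrite /occupation big_ord0 mulr0 subr0.
- move=> j; have gen := occupation_generator n j.
  have v1 := v_ge j.+1.
  have ie : e * (j < n)%:R <= e by rewrite -[leRHS]mulr1 ler_pM2l//; case: (j < n)%N.
  suff : e * (j < n)%:R <= l * (1 - e * occupation n j.+1).
    have := congr1 (fun x => e * x) gen => /=.
    set A := occupation n j.+2; set B := occupation n j.+1; set C := occupation n j.
    by rewrite mulrN => E; nra.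
  exact: le_trans v1.
Qed.

Lemma hit_laplace_lower l k n : 0 < l ->
  1 - l * ((M n - 1) / beta 0) - (beta 0 * s n.+1)^-1 <=
  hit_laplace l k 1 + (1 - hit_laplace 0 k 1).
Proof.
move=> l0; rewrite -occupation1 invfM -scale1.
(* The probability of reaching [n.+1] before 0 from [i]. Subtracting it makes the subsolution
   nonpositive from [n.+1] on, where the occupation no longer contributes to the generator. *)
pose h i := s (minn i n.+1) / s n.+1.
have sn := scale_gt0 n.
have hh i : (n < i)%N -> h i = 1.
  by move=> ni; rewrite /h (minn_idPr ni) divff// gt_eqF.
have h_ge0 i : 0 <= h i by rewrite divr_ge0 ?scale_ge0.
have h_le i : h i <= h i.+1.
  rewrite ler_pM2r ?invr_gt0//; apply: scale_le.
  by rewrite leq_min geq_minr (leq_trans (geq_minl _ _)).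
have -> : s 1 / s n.+1 = h 1%N by rewrite /h (minn_idPl _).
apply: (@hit_laplace_ge_sub _ _ _ (fun i => 1 - l * occupation n i - h i)).
- exact: ltW.
- move=> j; have := occupation_ge0 n j; have := h_ge0 j => hj oj.
  have : 0 <= l * occupation n j by rewrite mulr_ge0// ltW.
  lra.
- by rewrite /occupation big_ord0 /h min0n mul0r mulr0 !subr0.
- move=> j; have gen := occupation_generator n j.
  have b := beta_gt0 j.+1; have a := a0 j.
  have oj := mulr_ge0 (ltW l0) (occupation_ge0 n j.+1).
  have := congr1 (fun x => l * x) gen => /=.
  rewrite mulrN => E.
  suff : l * (1 - l * occupation n j.+1 - h j.+1) <=
     l * (j < n)%:R - (beta j.+1 * (h j.+2 - h j.+1) - alpha j.+1 * (h j.+1 - h j)) by lra.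
  (* On [[1, n]] the function [h] is harmonic and the occupation supplies [l], which dominates
     [l * v] as [v <= 1]. From [n.+1] on, [h] is constantly 1, so [l * v <= 0], while the concave
     kink of [h] at [n.+1] has the right sign. *)
  have [jn|nj] := ltnP j n.
    have -> : beta j.+1 * (h j.+2 - h j.+1) - alpha j.+1 * (h j.+1 - h j) = 0.
      rewrite /h (minn_idPl (_ : j.+2 <= n.+1)%N)// (minn_idPl (_ : j.+1 <= n.+1)%N) ?(leqW jn)//.
      rewrite (minn_idPl (_ : j <= n.+1)%N) ?(leqW (ltnW jn))//.
      rewrite -!mulrBl scaleS scaleSa.
      by have := inv_measure_gt0 j.+1 => mj; field; rewrite !gt_eqF.
    rewrite subr0 mulr1 -[leRHS]mulr1 ler_pM2l//.
    by have := h_ge0 j.+1; lra.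
  rewrite mulr0 sub0r (hh j.+1 nj) (hh j.+2 (leqW nj)) subrr mulr0 sub0r opprK.
  apply: (@le_trans _ _ 0).
    by rewrite pmulr_rle0//; lra.
  by rewrite mulr_ge0 ?(ltW a)// subr_ge0 -(hh j.+1 nj) h_le.
Qed.

(** If [s] were bounded by [S], the function [1 - s i / S] would be nonnegative and harmonic off 0,
    keeping the probability of hitting 0 from 1 below [1 - s 1 / S]. *)
Lemma scale_unbounded S : hit_laplace 0 n 1 @[n --> \oo] --> (1 : R) ->
  exists n, S < s n.
Proof.
move=> cv; apply: contrapT => /forallNP sS.
have {}sS n : s n <= S by rewrite leNgt; exact/negP.
have S0 : 0 < S := lt_le_trans (scale_gt0 0) (sS 1%N).
have ub n : hit_laplace 0 n 1 <= 1 - s 1 / S.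
  apply: (@hit_laplace_le_super _ _ _ (fun i => 1 - s i / S)) => //.
  - by move=> j; rewrite subr_ge0 ler_pdivrMr// mul1r.
  - by rewrite mul0r subr0.
  - move=> j; rewrite addr0.
    have b := beta_gt0 j.+1; have a := a0 j; have mj := inv_measure_gt0 j.+1.
    have e1 := scaleS j.+1; have e2 := scaleSa j.
    have h : beta j.+1 * (s j.+2 - s j.+1) - alpha j.+1 * (s j.+1 - s j) = 0.
      by rewrite e1 e2; field; rewrite !gt_eqF.
    have := congr1 (fun x => x / S) h; rewrite /= mul0r => h2; lra.
have : 1 <= 1 - s 1 / S.
  by rewrite -[leLHS](cvg_lim _ cv)//; apply: limr_le; [apply/cvg_ex; exists 1|apply: nearW => n; exact: ub].
have : 0 < s 1 / S by rewrite divr_gt0 ?scale_gt0.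
lra.
Qed.

End birth_death_potential.

(** * Jump times of a right-continuous process *)

Section jump_times.
Context {d : measure_display} {T : measurableType d} {R : realType}.
Variable X : R -> T -> nat.
Hypothesis mX : forall t, 0 <= t -> measurable_fun setT (X t).
Hypothesis X_rc : forall x t, 0 <= t -> \forall s \near t^'+, X s x = X t x.
Local Notation J := (jump_time X).
Local Notation Y := (jump_chain X).

Lemma right_constant x t : 0 <= t ->
  exists2 e : R, 0 < e & forall u, t <= u -> u < t + e -> X u x = X t x.
Proof.
move=> /(X_rc x); rewrite near_withinE => /nbhs_ballP[e /= e0 he].
exists e => // u; rewrite le_eqVlt => /predU1P[<-//|tu] ute.
by apply: he => //; rewrite /ball/= distrC gtr0_norm ?subr_gt0// ltrBlDl.
Qed.

(** Since [X] stays constant for a while after each time, a real time can be replaced by a slightly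
    later rational one. This makes the events below countable combinations of measurable ones. *)
Lemma right_constant_rat x t (b : \bar R) : 0 <= t -> (t%:E < b)%E ->
  exists r : rat, [/\ t < ratr r, ((ratr r)%:E < b)%E &
    forall u, t <= u -> u <= ratr r -> X u x = X t x].
Proof.
move=> t0 tb; have [e e0 he] := right_constant x t0.
have [c tc cb] : exists2 c, t < c & ((c%:E <= b)%E /\ c <= t + e).
  case: b tb => [b tb|_|]; last by rewrite ltNge leNye.
    exists (Num.min b (t + e)); first by rewrite lt_min -lte_fin tb ltrDl.
    by rewrite lee_fin !ge_min !lexx orbT.
  by exists (t + e); rewrite ?ltrDl// leey.
have [r] := rat_in_itvoo tc; rewrite in_itv/= => /andP[tr rc].
exists r; split => //; first by rewrite (lt_le_trans _ cb.1)// lte_fin.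
by move=> u tu ur; apply: he => //; rewrite (le_lt_trans ur)// (lt_le_trans rc)// cb.2.
Qed.

Lemma jump_time_le k x : (J k x <= J k.+1 x)%E.
Proof. by apply: le_ereal_inf_tmp => _ [t [Jt _] <-]. Qed.

Lemma jump_time_ge0 k x : (0 <= J k x)%E.
Proof. by elim: k => [|k /le_trans] //; apply; exact: jump_time_le. Qed.

Lemma jump_time_homo m n x : (m <= n)%N -> (J m x <= J n x)%E.
Proof.
apply: (homo_leq (f := fun n => J n x) (r := fun a b => (a <= b)%E)) => //.
  by move=> ? ? ?; exact: le_trans.
by move=> k; exact: jump_time_le.
Qed.

Lemma jump_time_lt k x : (J k x < +oo)%E -> (J k x < J k.+1 x)%E.
Proof.
have := jump_time_ge0 k x; case E : (J k x) => [s| |]// s0 _.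
have [e e0 he] := right_constant x s0.
apply: (@lt_le_trans _ _ (s + e)%:E); first by rewrite lte_fin ltrDl.
apply: le_ereal_inf_tmp => _ [t [+ +] <-].
rewrite -/(jump_time X k x) E !lee_fin /= => st Xt.
by rewrite leNgt; apply/negP => tse; apply: Xt; exact: he.
Qed.

Lemma jump_chain_between k x t : (J k x <= t%:E)%E -> (t%:E < J k.+1 x)%E ->
  X t x = Y k x.
Proof.
move=> Jt tJ; apply: contrapT => Xt.
have : (J k.+1 x <= t%:E)%E by apply: ereal_inf_lbound; exists t.
by rewrite leNgt tJ.
Qed.

Let measurable_X (r : R) i : 0 <= r -> measurable [set x | X r x = i].
Proof.
move=> r0; have := mX r0 measurableT (Y := [set i]).
rewrite setTI; exact.
Qed.

Let measurable_erealfun (f : T -> \bar R) :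
  (forall a : R, measurable [set x | (f x < a%:E)%E]) -> measurable_fun setT f.
Proof.
move=> h; apply: (measurability _ (ErealGenInftyO.measurableE R)).
move=> _ [_ [r ->] <-]; rewrite setTI.
have -> : f @^-1` `]-oo, r%:E[ = [set x | (f x < r%:E)%E] by apply/seteqP; split => x /=; rewrite in_itv.
exact: h.
Qed.

Let measurable_lt (f : T -> \bar R) (a : \bar R) : measurable_fun setT f ->
  measurable [set x | (f x < a)%E].
Proof. by move=> mf; rewrite -[X in measurable X]setTI; apply: emeasurable_fun_infty_o. Qed.

Let jump_timeE k x (b : \bar R) : (J k x < b)%E ->
  exists2 t, 0 <= t & J k x = t%:E.
Proof.
move=> Jb; have := jump_time_ge0 k x.
case: (J k x) Jb => [t _ t0||]//; first by exists t.
by rewrite ltNge leey.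
Qed.

(** For finite [J k], the state [Y k] is [i] exactly if [X] equals [i] at all rational times in []J
    k, r]] for some rational [r > J k]. The second member of the union covers [J k = +oo], where
    [fine] returns 0 and [Y k] is read at time 0. *)
Let measurable_jump_chain_of k i : measurable_fun setT (J k) ->
  measurable [set x | Y k x = i].
Proof.
move=> mJ.
pose A (r q : rat) : set T := ~` [set x | (J k x < (ratr q)%:E)%E] `|`
  (if r < q then setT else [set x | X (Num.max 0 (ratr q)) x = i]).
have -> : [set x | Y k x = i] =
  (\bigcup_(r : rat) ([set x | (J k x < (ratr r)%:E)%E] `&` \bigcap_(q : rat) A r q)) `|`
  (~` [set x | (J k x < +oo)%E] `&` [set x | X 0 x = i]).
  apply/seteqP; split => [x /= Yi|x /=].
    have [Joo|Joo] := ltP (J k x) +oo%E; last first.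
      right; split; first by [].
      by move: Yi; rewrite /jump_chain; move: Joo; rewrite leye_eq => /eqP ->.
    left; have [t t0 Jt] := jump_timeE Joo.
    have [r [tr _ hr]] := right_constant_rat x t0 (ltry t).
    exists r => //; split => /=; first by rewrite Jt lte_fin.
    move=> q _; rewrite /A; have [Jq|Jq] := ltP (J k x) (ratr q)%:E; last first.
      by left => /=; rewrite ltNge Jq.
    right; case: ltP => // qr /=.
    have tq : t < ratr q by rewrite -lte_fin -Jt.
    rewrite max_r ?(le_trans t0 (ltW tq))// hr ?(ltW tq)// ?ler_rat//.
    by move: Yi; rewrite /jump_chain Jt.
  move=> [[r _ /= [Jr h]]|[Joo <-]]; last first.
    by move: Joo => /negP; rewrite -leNgt leye_eq /jump_chain => /eqP ->.
  have [t t0 Jt] := jump_timeE Jr.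
  have tr : (t%:E < (ratr r)%:E)%E by rewrite -Jt.
  have [q [tq qr hq]] := right_constant_rat x t0 tr.
  case: (h q I) => /=; first by rewrite Jt lte_fin tq.
  rewrite lte_fin ltr_rat in qr; rewrite ltNge (ltW qr)/=.
  by rewrite max_r ?(le_trans t0 (ltW tq))// hq ?(ltW tq)// /jump_chain Jt.
apply: measurableU.
  apply: bigcupT_measurable_rat => r; apply: measurableI; first exact: measurable_lt.
  rewrite -[X in measurable X]setCK setC_bigcap; apply: measurableC.
  apply: bigcupT_measurable_rat => q; apply: measurableC; apply: measurableU.
    by apply: measurableC; exact: measurable_lt.
  by case: ifP => // _; apply: measurable_X; rewrite le_max lexx.
apply: measurableI; last exact: measurable_X.
by apply: measurableC; exact: measurable_lt.
Qed.

Lemma measurable_jump_time k : measurable_fun setT (J k).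
Proof.
elim: k => [|k IH]; first exact: measurable_cst.
apply: measurable_erealfun => a.
(* A jump before [a] is witnessed at a rational time [r < a] after [J k]. The disagreement of [X]
   with [Y k] is split over the countably many values of [Y k]; [Num.max 0] keeps the time
   nonnegative. *)
have -> : [set x | (J k.+1 x < a%:E)%E] =
  \bigcup_(r : rat) (if ratr r < a then [set x | (J k x < (ratr r)%:E)%E] `&`
    \bigcup_i (~` [set x | X (Num.max 0 (ratr r)) x = i] `&` [set x | Y k x = i])
    else set0).
  apply/seteqP; split => x /=.
    move=> /ereal_inf_lt[_ [t [Jt Xt] <-] ta].
    have t0 : 0 <= t by rewrite -lee_fin (le_trans (jump_time_ge0 k x)).
    have [r [tr ra hr]] := right_constant_rat x t0 ta.
    exists r => //; rewrite -lte_fin ra /=; split; first by rewrite (le_lt_trans Jt)// lte_fin.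
    exists (Y k x) => //; split => //=.
    by rewrite max_r ?(le_trans t0 (ltW tr))// hr// ltW.
  move=> [r _]; case: ifP => // ra [/= Jr [i _ [/= Xr Yi]]].
  have [t t0 Jt] := jump_timeE Jr.
  apply: (@le_lt_trans _ _ (ratr r)%:E); last by rewrite lte_fin.
  apply: ereal_inf_lbound; exists (ratr r) => //; split; first exact: ltW.
  move: Xr; rewrite -Yi max_r//.
  by rewrite (le_trans t0)// -lee_fin -Jt ltW.
apply: bigcupT_measurable_rat => r; case: ifP => // _; apply: measurableI.
  exact: measurable_lt.
apply: bigcup_measurable => i _; apply: measurableI.
  by apply: measurableC; apply: measurable_X; rewrite le_max lexx.
exact: measurable_jump_chain_of.
Qed.

Lemma measurable_jump_chain k i : measurable [set x | Y k x = i].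
Proof. by apply: measurable_jump_chain_of; exact: measurable_jump_time. Qed.

Lemma measurable_holding_time k : measurable_fun setT (holding_time X k).
Proof. by apply: emeasurable_funB; exact: measurable_jump_time. Qed.

Local Arguments jump_time : simpl never.

Lemma measurable_return_time i : measurable_fun setT (return_time X i).
Proof.
apply: measurable_erealfun => a.
have -> : [set x | (return_time X i x < a%:E)%E] =
  \bigcup_(r : rat) (if ratr r < a then [set x | (J 1 x < (ratr r)%:E)%E] `&`
    [set x | X (Num.max 0 (ratr r)) x = i] else set0).
  apply/seteqP; split => x /=.
    move=> /ereal_inf_lt[_ [t [Jt Xt] <-] ta].
    have t0 : 0 <= t by rewrite -lee_fin (le_trans (jump_time_ge0 1 x))// ltW.
    have [r [tr ra hr]] := right_constant_rat x t0 ta.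
    exists r => //; rewrite -lte_fin ra /=; split; first by rewrite (lt_trans Jt)// lte_fin.
    by rewrite max_r ?(le_trans t0 (ltW tr))// hr// ltW.
  move=> [r _]; case: ifP => // ra [/= Jr Xr].
  have [t t0 Jt] := jump_timeE Jr.
  apply: (@le_lt_trans _ _ (ratr r)%:E); last by rewrite lte_fin.
  apply: ereal_inf_lbound; exists (ratr r) => //; split => //.
  move: Xr; rewrite max_r//.
  by rewrite (le_trans t0)// -lee_fin -Jt ltW.
apply: bigcupT_measurable_rat => r; case: ifP => // _; apply: measurableI.
  by apply: measurable_lt; exact: measurable_jump_time.
by apply: measurable_X; rewrite le_max lexx.
Qed.

Lemma return_time_ge0 i x : (0 <= return_time X i x)%E.
Proof.
apply: le_ereal_inf_tmp => _ [t [Jt _] <-].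
by rewrite (le_trans (jump_time_ge0 1 x))// ltW.
Qed.

Lemma jump_index x (t : R) : 0 <= t ->
  J n x @[n --> \oo] --> +oo%E ->
  exists k, (J k x <= t%:E)%E /\ (t%:E < J k.+1 x)%E.
Proof.
move=> t0 Joo.
have ex : exists k, (t%:E < J k x)%E.
  have : \forall k \near \oo, (t%:E < J k x)%E.
    by move/cvgey_gt : Joo; apply.
  by move=> [N _ hN]; exists N; apply: hN => /=.
case: (ex_minnP ex) => -[|k] tJ kmin.
  by move: tJ; rewrite /jump_time lte_fin ltNge t0.
exists k; split => //; rewrite leNgt; apply/negP => /kmin.
by rewrite ltnn.
Qed.

Lemma return_time_first x p i : (forall n, (J n x < +oo)%E) ->
  J n x @[n --> \oo] --> +oo%E ->
  Y p.+1 x = i -> (forall l, (l < p)%N -> Y l.+1 x <> i) ->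
  return_time X i x = J p.+1 x.
Proof.
move=> Jfin Joo Yp Ymin; apply/eqP; rewrite eq_le; apply/andP; split.
  have [s s0 Js] := jump_timeE (Jfin p.+1).
  (* The return time is an infimum over times strictly after [J 1], so for [p = 0] the value [J 1]
     is only approached. Times just after [J p.+1] treat all cases alike. *)
  rewrite Js; apply/lee_addgt0Pr => e e0.
  have se : (s%:E < (s + e)%:E)%E by rewrite lte_fin ltrDl.
  have [r [sr re hr]] := right_constant_rat x s0 se.
  apply: (@le_trans _ _ (ratr r)%:E); last by rewrite EFinD in re; exact: ltW.
  apply: ereal_inf_lbound; exists (ratr r) => //; split.
    by rewrite (le_lt_trans (jump_time_homo x (ltn0Sn p)))// Js lte_fin.
  by rewrite hr ?(ltW sr)// -Yp /jump_chain Js.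
apply: le_ereal_inf_tmp => _ [t [Jt Xt] <-].
have t0 : 0 <= t by rewrite -lee_fin (le_trans (jump_time_ge0 1 x))// ltW.
have [k [Jk tJ]] := jump_index t0 Joo.
have k0 : (0 < k)%N.
  case: k Jk tJ => // _; rewrite ltNge => /negP[]; exact: ltW.
apply: (le_trans _ Jk); apply: jump_time_homo.
rewrite leqNgt; apply/negP => kp.
apply: (Ymin k.-1); first by rewrite prednK.
by rewrite prednK// -(jump_chain_between Jk tJ).
Qed.

Lemma return_time_finite x i : (forall n, (J n x < +oo)%E) ->
  J n x @[n --> \oo] --> +oo%E -> (return_time X i x < +oo)%E ->
  exists p, Y p.+1 x = i /\ (forall l, (l < p)%N -> Y l.+1 x <> i).
Proof.
move=> Jfin Joo /ereal_inf_lt[_ [t [Jt Xt] <-] _].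
have t0 : 0 <= t by rewrite -lee_fin (le_trans (jump_time_ge0 1 x))// ltW.
have [k [Jk tJ]] := jump_index t0 Joo.
have [p kE] : exists p, k = p.+1.
  case: k Jk tJ => [_|p _ _]; last by exists p.
  by rewrite ltNge => /negP[]; exact: ltW.
have ex : exists p, Y p.+1 x == i.
  by exists p; rewrite -kE -(jump_chain_between Jk tJ); exact/eqP.
case: (ex_minnP ex) => q /eqP Yq qmin; exists q; split => // l lq /eqP /qmin.
by rewrite leqNgt lq.
Qed.

End jump_times.

(** * Laplace transforms of the jump times *)

Section laplace_of_survival.
Context {R : realType}.
Local Notation mu := (@lebesgue_measure R).

Lemma measurable_bool_natr d' (U : measurableType d') (p : pred U) :
  measurable [set x | p x] -> measurable_fun setT (fun x => (p x)%:R : R).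
Proof.
move=> mp; have -> : (fun x => (p x)%:R) = \1_[set x | p x] :> (U -> R).
  apply/funext => x; rewrite indicE; case: (boolP (p x)) => h.
    by rewrite mem_set.
  by rewrite memNset//; exact/negP.
exact: measurable_indic.
Qed.

(* The indicator makes the weight vanish at [+oo] and at the meaningless holding
   times that follow an infinite jump time. *)
Definition laplace_weight (l : R) (h : \bar R) : R :=
  (0 < h < +oo)%E%:R * expR (- l * fine h).

Lemma laplace_weight_ge0 l h : 0 <= laplace_weight l h.
Proof. by rewrite mulr_ge0// expR_ge0. Qed.

Lemma laplace_weight_le l h : 0 < l -> laplace_weight l h <= (0 < h)%E%:R.
Proof.
move=> l0; rewrite /laplace_weight; case: ltP => h0; last by rewrite mul0r.
case: (ltP h +oo%E) => hoo; last by rewrite mul0r.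
by rewrite mul1r -expR0 ler_expR mulNr oppr_le0 mulr_ge0 ?(ltW l0)// fine_ge0// ltW.
Qed.

Lemma integral_exponential_pdf_lt l (h : \bar R) : 0 < l ->
  (\int[mu]_t (exponential_pdf l t * (t%:E < h)%E%:R)%:E =
   ((0 < h)%E%:R - laplace_weight l h)%:E)%E.
Proof.
move=> l0; rewrite /laplace_weight; case: h => [r| |]; last 2 first.
- under eq_integral do rewrite ltry mulr1.
  by rewrite integral_exponential_pdf// ltry ltxx mul0r subr0.
- under eq_integral do rewrite ltNge leNye mulr0.
  by rewrite integral0 ltNge leNye mul0r subr0.
rewrite ltry andbT lte_fin; case: ltP => r0; last first.
  rewrite mul0r subr0; apply: integral0_eq => t _.
  rewrite lte_fin; case: ltP => tr; last by rewrite mulr0.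
  by rewrite lt0_exponential_pdf ?mul0r// (lt_le_trans tr).
rewrite mul1r EFinB -(exponential_prob_itv0c _ r0) /exponential_prob.
rewrite -integral_itv_bndo_bndc; last first.
  by apply/measurable_EFinP; apply: measurable_funTS; exact: measurable_exponential_pdf.
rewrite [RHS]integral_mkcond; apply: eq_integral => t _.
rewrite patchE lte_fin; have [t0|t0] := ltP t 0.
  rewrite lt0_exponential_pdf// mul0r; case: ifPn => //.
case: ltP => tr.
  by rewrite mulr1 mem_set//= in_itv/= t0 tr.
rewrite mulr0 memNset//= in_itv/= t0/=; apply/negP; by rewrite -leNgt.
Qed.

Context {d} {T : measurableType d} (P : probability T R).

Lemma measurable_laplace_weight l (H : T -> \bar R) : measurable_fun setT H ->
  measurable_fun setT (fun x => laplace_weight l (H x)).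
Proof.
move=> mH; apply: measurable_funM.
  apply: measurable_bool_natr.
  have -> : [set x | (0 < H x < +oo)%E] = [set x | (0 < H x)%E] `&` [set x | (H x < +oo)%E].
    by apply/seteqP; split => x /= => [/andP[]|[-> ->]].
  apply: measurableI; rewrite -[X in measurable X]setTI.
    exact: emeasurable_fun_o_infty.
  exact: emeasurable_fun_infty_o.
apply: measurableT_comp => //; apply: measurable_funM => //.
exact: measurableT_comp.
Qed.

(** Compare [H] with an independent exponential clock of parameter [l]. Integrating the survival
    hypothesis against the clock's density gives, by Tonelli, the weight [c * (l / (q + l))] of the
    event that the clock rings before [H]; the Laplace weight is what remains of [c]. The factor [Z]
    carries the path and the other holding times. *)
Lemma integral_laplace_of_survival l q c (H : T -> \bar R) (Z : T -> R) :
  0 < l -> 0 < q ->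
  measurable_fun setT H -> measurable_fun setT Z -> (forall x, 0 <= Z x) ->
  (forall t, 0 <= t ->
    (\int[P]_x (Z x * (t%:E < H x)%E%:R)%:E = (c * expR (- q * t))%:E)%E) ->
  (\int[P]_x (Z x * laplace_weight l (H x))%:E = (c * (q / (q + l)))%:E)%E.
Proof.
move=> l0 q0 mH mZ Z0 surv.
have c0 : 0 <= c.
  have := surv 0 (lexx 0); rewrite mulr0 expR0 mulr1 => E.
  rewrite -lee_fin -E; apply: integral_ge0 => x _.
  by rewrite lee_fin mulr_ge0.
have mlt t : measurable_fun setT (fun x => (t < H x)%E%:R : R).
  apply: measurable_bool_natr; rewrite -[X in measurable X]setTI.
  exact: emeasurable_fun_o_infty.
pose G (z : T * R) : \bar R := (Z z.1 * (exponential_pdf l z.2 * (z.2%:E < H z.1)%E%:R))%:E.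
have G0 z : (0 <= G z)%E.
  by rewrite lee_fin mulr_ge0// mulr_ge0// exponential_pdf_ge0// ltW.
have mG : measurable_fun setT G.
  apply/measurable_EFinP; apply: measurable_funM; first exact: measurableT_comp.
  apply: measurable_funM.
    by apply: measurableT_comp => //; exact: measurable_exponential_pdf.
  apply: measurable_bool_natr; rewrite -[X in measurable X]setTI.
  apply: measurable_lte => //; apply: measurableT_comp => //.
have mL : measurable_fun setT (fun x => laplace_weight l (H x)).
  exact: measurable_laplace_weight.
have I1 : (\int[P]_x (Z x * ((0 < H x)%E%:R - laplace_weight l (H x)))%:E =
    (c * (l / (q + l)))%:E)%E.
  transitivity (\int[P]_x \int[mu]_t G (x, t))%E.
    apply: eq_integral => x _; rewrite EFinM -integral_exponential_pdf_lt//.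
    rewrite -ge0_integralZl//.
    - apply/measurable_EFinP; apply: measurable_funM; first exact: measurable_exponential_pdf.
      apply: measurable_bool_natr; rewrite -[X in measurable X]setTI.
      exact: emeasurable_fun_infty_o.
    - by move=> t _; rewrite lee_fin mulr_ge0// exponential_pdf_ge0// ltW.
    - by rewrite lee_fin.
  rewrite (fubini_tonelli (m1 := P) (m2 := mu) G mG G0).
  transitivity (\int[mu]_t ((c * (l / (q + l)))%:E * (exponential_pdf (q + l) t)%:E))%E.
    apply: eq_integral => t _.
    have [t0|t0] := ltP t 0.
      rewrite lt0_exponential_pdf// mule0; apply: integral0_eq => x _.
      by rewrite /G/= lt0_exponential_pdf// mul0r mulr0.
    transitivity (\int[P]_x ((exponential_pdf l t)%:E * (Z x * (t%:E < H x)%E%:R)%:E))%E.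
      by apply: eq_integral => x _; rewrite -EFinM /G/=; congr EFin; ring.
    rewrite ge0_integralZl//; last 3 first.
    - by apply/measurable_EFinP; exact: measurable_funM.
    - by move=> x _; rewrite lee_fin mulr_ge0.
    - by rewrite lee_fin exponential_pdf_ge0// ltW.
    rewrite surv// -!EFinM !exponential_pdfE//; congr EFin.
    have -> : expR (- (q + l) * t) = expR (- q * t) * expR (- l * t).
      by rewrite -expRD; congr expR; ring.
    by field; lra.
  rewrite ge0_integralZl//.
  - by rewrite integral_exponential_pdf ?addr_gt0// mule1.
  - by apply/measurable_EFinP; exact: measurable_exponential_pdf.
  - by move=> t _; rewrite lee_fin exponential_pdf_ge0// addr_ge0// ltW.
  - by rewrite lee_fin mulr_ge0// divr_ge0 ?addr_ge0 ?ltW.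
have := surv 0 (lexx 0); rewrite mulr0 expR0 mulr1.
under eq_integral.
  move=> x _; rewrite (_ : Z x * _ = Z x * laplace_weight l (H x) +
    Z x * ((0 < H x)%E%:R - laplace_weight l (H x))); last by ring.
  rewrite EFinD; over.
rewrite ge0_integralD//; last 4 first.
- by move=> x _; rewrite lee_fin mulr_ge0// laplace_weight_ge0.
- by apply/measurable_EFinP; exact: measurable_funM.
- by move=> x _; rewrite lee_fin mulr_ge0// subr_ge0 laplace_weight_le.
- by apply/measurable_EFinP; apply: measurable_funM => //; exact: measurable_funB.
rewrite I1; set I := (\int[P]_x _)%E => E.
have -> : I = (c%:E - (c * (l / (q + l)))%:E)%E by rewrite -E addeK.
rewrite -EFinB; congr EFin; field; lra.
Qed.

End laplace_of_survival.

Section laplace_of_jump_times.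
Context {d : measure_display} {T : measurableType d} {R : realType}.
Variables (P : probability T R) (X : R -> T -> nat) (Q : nat -> nat -> R) (x0 : nat).
Hypothesis hX : markov_chain P X Q x0.
Hypothesis Q_lt0 : forall i, Q i i < 0.
Local Notation J := (jump_time X).
Local Notation Y := (jump_chain X).
Local Notation H := (holding_time X).
Local Notation q i := (- Q i i).

Local Arguments jump_time : simpl never.

Let mX t : 0 <= t -> measurable_fun setT (X t). Proof. by have [+ _ _ _ _] := hX; apply. Qed.
Let X_rc x t : 0 <= t -> \forall s \near t^'+, X s x = X t x.
Proof. by have [_ + _ _ _] := hX; apply. Qed.
Let q_gt0 i : 0 < q i. Proof. by rewrite oppr_gt0. Qed.

Definition cylinder (n : nat) (i : nat -> nat) : set T :=
  [set x | forall k, (k <= n)%N -> Y k x = i k].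

Lemma measurable_cylinder n i : measurable (cylinder n i).
Proof.
have -> : cylinder n i = \bigcap_k (if (k <= n)%N then [set x | Y k x = i k] else setT).
  apply/seteqP; split => x; first by move=> h k _; case: ifP => // /h.
  by move=> h k kn; have := h k I; rewrite kn.
apply: bigcapT_measurable => k; case: ifP => // _.
exact: measurable_jump_chain.
Qed.

Let mJ k : measurable_fun setT (J k). Proof. exact: measurable_jump_time. Qed.
Let mH k : measurable_fun setT (H k). Proof. exact: measurable_holding_time. Qed.

Let mJlt k a : measurable [set x | (J k x < a)%E].
Proof. by rewrite -[X in measurable X]setTI; exact: emeasurable_fun_infty_o. Qed.

(** An infinite holding time exceeds every [N], which along a fixed path has probability at most
    [exp (- q * N) <= 1 / (1 + q * N)]. *)
Let escape n i : P (cylinder n i `&` [set x | (J n x < +oo)%E] `&` ~` [set x | (J n.+1 x < +oo)%E]) = 0%E.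
Proof.
have mB : measurable (cylinder n i `&` [set x | (J n x < +oo)%E] `&` ~` [set x | (J n.+1 x < +oo)%E]).
  apply: measurableI; last by apply: measurableC; exact: mJlt.
  by apply: measurableI; [exact: measurable_cylinder|exact: mJlt].
apply/eqP; rewrite eq_le measure_ge0 andbT.
suff h N : (P (cylinder n i `&` [set x | (J n x < +oo)%E] `&` ~` [set x | (J n.+1 x < +oo)%E]) <=
    (1 + q (i n) * N%:R)^-1%:E)%E.
  apply/lee_addgt0Pr => e e0; rewrite add0e.
  apply: le_trans (h (Num.bound (e^-1 / q (i n)))) _; rewrite lee_fin.
  have b0 : e^-1 / q (i n) < (Num.bound (e^-1 / q (i n)))%:R.
    by apply: archi_boundP; rewrite divr_ge0 ?invr_ge0 ?(ltW e0)// ltW.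
  rewrite -[leRHS]invrK lef_pV2 ?posrE ?invr_gt0//; last first.
    by rewrite ltr_pwDl// mulr_ge0// ltW.
  by move: b0; rewrite ltr_pdivrMr// mulrC => /ltW b0; rewrite (le_trans b0)// lerDr.
(* Only the last holding time is tested against [N]; threshold 0 for the earlier ones is passed
   because finite jump times strictly increase. *)
pose t k : R := if k == n then N%:R else 0.
have t0 k : 0 <= t k by rewrite /t; case: ifP.
have [_ _ _ _ /(_ n i t t0) joint] := hX.
have mset : measurable [set x | forall k, (k <= n)%N -> Y k x = i k /\ ((t k)%:E < H k x)%E].
  have -> : [set x | forall k, (k <= n)%N -> Y k x = i k /\ ((t k)%:E < H k x)%E] =
    \bigcap_k (if (k <= n)%N then [set x | Y k x = i k] `&` [set x | (t k)%:E < H k x]%E else setT).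
    apply/seteqP; split => x; first by move=> h k _; case: ifP => // /h.
    by move=> h k kn; have := h k I; rewrite kn.
  apply: bigcapT_measurable => k; case: ifP => // _; apply: measurableI.
    exact: measurable_jump_chain.
  by rewrite -[X in measurable X]setTI; exact: emeasurable_fun_o_infty.
apply: (@le_trans _ _ (P [set x | forall k, (k <= n)%N -> Y k x = i k /\ ((t k)%:E < H k x)%E])).
  apply: le_measure; rewrite ?inE//.
  move=> x /= [[Cx Jn] /negP]; rewrite -leNgt leye_eq => /eqP Jn1 k kn; split; first exact: Cx.
  have Jk : (J k x < +oo)%E by apply: le_lt_trans Jn; exact: jump_time_homo.
  rewrite /t; case: eqP => [->|_]; last first.
    rewrite /holding_time sube_gt0; exact: jump_time_lt.
  rewrite /holding_time Jn1; have := jump_time_ge0 X n x.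
  by case: (J n x) Jn => // r _ _; rewrite ltry.
rewrite joint.
have -> : \prod_(0 <= k < n.+1) expR (Q (i k) (i k) * t k) = expR (- (q (i n) * N%:R)).
  rewrite big_nat_recr//= big1_seq ?mul1r.
    by rewrite /t eqxx mulNr opprK.
  move=> k; rewrite mem_index_iota => /andP[_ /andP[_ kn]].
  by rewrite /t ltn_eqF// mulr0 expR0.
apply: (@le_trans _ _ (1 * (expR (- (q (i n) * N%:R)))%:E)%E).
  by apply: lee_wpmul2r; [rewrite lee_fin expR_ge0|exact: probability_le1 (measurable_cylinder _ _)].
rewrite mul1e lee_fin expRN lef_pV2 ?posrE ?expR_gt0 ?expR_ge1Dx//.
by rewrite ltr_pwDl// mulr_ge0// ltW.
Qed.

Lemma ae_jump_time_finite : {ae P, forall x, forall n, (J n x < +oo)%E}.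
Proof.
(* Countably many finite paths, coded as sequences, cover the bad event: follow the path up to its
   last finite jump time. *)
pose B (p : nat * seq nat) := cylinder p.1 (nth 0%N p.2) `&`
  [set x | (J p.1 x < +oo)%E] `&` ~` [set x | (J p.1.+1 x < +oo)%E].
pose F k := if unpickle k is Some p then B p else set0.
apply: (@negligibleS _ _ _ P (\bigcup_k F k)).
  move=> x /= /existsNP[n]; elim: n => [|n IH]; first by rewrite /jump_time ltry.
  have [Jn Jn1|/IH//] := pselect (J n x < +oo)%E.
  exists (pickle (n, mkseq (fun k => Y k x) n.+1)) => //.
  rewrite /F pickleK /B/=; split.
    by split=> //= k kn; rewrite nth_mkseq.
  by [].
apply: negligible_bigcup => k; rewrite /F; case: unpickle => [p|]; last exact: negligible_set0.
apply/negligibleP; last exact: escape.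
apply: measurableI; last by apply: measurableC; exact: mJlt.
by apply: measurableI; [exact: measurable_cylinder|exact: mJlt].
Qed.

Let prod_bool (b : nat -> bool) (s : seq nat) : \prod_(k <- s) (b k)%:R = (all b s)%:R :> R.
Proof.
elim: s => [|k s IH]; first by rewrite big_nil.
by rewrite big_cons IH /= -natrM mulnb.
Qed.

(** Induction on the number [j] of holding times whose survival indicator has been replaced by a
    Laplace weight. Keeping the other thresholds arbitrary lets the next one vary as the time
    variable of [integral_laplace_of_survival]. *)
Let joint_laplace l n i j t : 0 < l -> (j <= n.+1)%N -> (forall k, 0 <= t k) ->
  (\int[P]_x (\1_(cylinder n i) x * (\prod_(0 <= k < j) laplace_weight l (H k x) *
      \prod_(j <= k < n.+1) ((t k)%:E < H k x)%E%:R))%:E =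
  (fine (P (cylinder n i)) * (\prod_(0 <= k < j) (q (i k) / (q (i k) + l)) *
     \prod_(j <= k < n.+1) expR (- q (i k) * t k)))%:E)%E.
Proof.
move=> l0; elim: j t => [|j IH] t jn t0.
  rewrite [in RHS](@big_geq _ _ _ 0 0)// mul1r.
  have [_ _ _ _ /(_ n i t t0) joint] := hX.
  set S := [set x | _] in joint.
  have mS : measurable S.
    have -> : S =
      \bigcap_k (if (k <= n)%N then [set x | Y k x = i k] `&` [set x | (t k)%:E < H k x]%E else setT).
      apply/seteqP; split => x; first by move=> h k _; case: ifP => // /h.
      by move=> h k kn; have := h k I; rewrite kn.
    apply: bigcapT_measurable => k; case: ifP => // _; apply: measurableI.
      exact: measurable_jump_chain.
    by rewrite -[X in measurable X]setTI; exact: emeasurable_fun_o_infty.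
  transitivity (P S).
    rewrite -(setIT S) -integral_indic//; apply: eq_integral => x _.
    rewrite (@big_geq _ _ _ 0 0)// mul1r prod_bool !indicE -natrM mulnb; congr (_%:R%:E); congr nat_of_bool.
    apply/idP/idP => [/andP[/set_mem Cx /allP h]|/set_mem Sx].
      apply/mem_set => k kn; split; first exact: Cx.
      by apply: h; rewrite mem_index_iota.
    apply/andP; split; first by apply/mem_set => k /Sx[].
    by apply/allP => k; rewrite mem_index_iota/= ltnS => /Sx[].
  rewrite joint EFinM fineK; last by apply: fin_num_measure; exact: measurable_cylinder.
  by under [in RHS]eq_bigr do rewrite opprK.
have jn1 := jn; rewrite ltnS in jn.
pose Z x : R := \1_(cylinder n i) x * (\prod_(0 <= k < j) laplace_weight l (H k x) *
  \prod_(j.+1 <= k < n.+1) ((t k)%:E < H k x)%E%:R).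
pose c : R := fine (P (cylinder n i)) * (\prod_(0 <= k < j) (q (i k) / (q (i k) + l)) *
     \prod_(j.+1 <= k < n.+1) expR (- q (i k) * t k)).
transitivity (\int[P]_x (Z x * laplace_weight l (H j x))%:E)%E.
  by apply: eq_integral => x _; rewrite big_nat_recr//= /Z; congr EFin; ring.
rewrite (@integral_laplace_of_survival R _ _ P l (q (i j)) c)//.
- by rewrite big_nat_recr//= /c; congr EFin; ring.
- apply: measurable_funM; first by apply: measurable_indic; exact: measurable_cylinder.
  apply: measurable_funM.
    by apply: measurable_prod => k _; exact: measurable_laplace_weight.
  apply: measurable_prod => k _; apply: measurable_bool_natr.
  by rewrite -[X in measurable X]setTI; exact: emeasurable_fun_o_infty.
- move=> x; rewrite /Z mulr_ge0// mulr_ge0//; apply: prodr_ge0 => k _ //.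
  exact: laplace_weight_ge0.
- move=> s s0.
  pose t' k := if k == j then s else t k.
  have t'0 k : 0 <= t' k by rewrite /t'; case: ifP.
  have := IH t' (leqW jn) t'0.
  have t'j : t' j = s by rewrite /t' eqxx.
  rewrite (big_ltn jn1) t'j.
  have e1 x : \prod_(j.+1 <= k < n.+1) ((t' k)%:E < H k x)%E%:R =
      \prod_(j.+1 <= k < n.+1) ((t k)%:E < H k x)%E%:R :> R.
    by apply: eq_big_nat => k /andP[jk _]; rewrite /t' gtn_eqF.
  have e2 : \prod_(j.+1 <= k < n.+1) expR (- q (i k) * t' k) =
      \prod_(j.+1 <= k < n.+1) expR (- q (i k) * t k) :> R.
    by apply: eq_big_nat => k /andP[jk _]; rewrite /t' gtn_eqF.
  rewrite e2 => E; transitivity (c * expR (- q (i j) * s))%:E%E; last by [].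
  rewrite [RHS](_ : _ = (fine (P (cylinder n i)) * (\prod_(0 <= k < j) (q (i k) / (q (i k) + l)) *
    (expR (- q (i j) * s) * \prod_(j.+1 <= k < n.+1) expR (- q (i k) * t k))))%:E); last first.
    by rewrite /c; congr EFin; ring.
  rewrite -E; apply: eq_integral => x _; rewrite (big_ltn jn1) e1 t'j /Z.
  by congr EFin; ring.
Qed.

Definition path_weight (l : R) (n : nat) (i : nat -> nat) : R :=
  (i 0%N == x0)%:R *
  \prod_(0 <= k < n) (jump_matrix Q (i k) (i k.+1) * (q (i k) / (q (i k) + l))).

Let measurable_laplace_jump l k :
  measurable_fun setT (fun x => expR (- l * fine (J k x)) : R).
Proof.
apply: measurableT_comp => //; apply: measurable_funM => //.
exact: measurableT_comp.
Qed.

Let prod_laplace_weight l x n : (forall k, (J k x < +oo)%E) ->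
  \prod_(0 <= k < n) laplace_weight l (H k x) = expR (- l * fine (J n x)) /\ (0 < H n x)%E.
Proof.
move=> Jfin.
have Hk k : exists r r', [/\ J k x = r%:E, J k.+1 x = r'%:E & r < r'].
  have := jump_time_lt X_rc (Jfin k).
  have := Jfin k; have := jump_time_ge0 X k x.
  have := Jfin k.+1; have := jump_time_ge0 X k.+1 x.
  case: (J k x) => [r| |]//; case: (J k.+1 x) => [r'| |]// _ _ _ _.
  by rewrite lte_fin; exists r, r'.
split; last first.
  have [r [r' [Jr Jr' rr']]] := Hk n.
  by rewrite /holding_time Jr Jr' -EFinB lte_fin subr_gt0.
elim: n => [|n IH]; first by rewrite big_geq// /jump_time/= mulr0 expR0.
rewrite big_nat_recr//= IH.
have [r [r' [Jr Jr' rr']]] := Hk n.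
rewrite /laplace_weight /holding_time Jr Jr' -EFinB lte_fin ltry subr_gt0 rr' mul1r/=.
by rewrite -expRD; congr expR; ring.
Qed.

Lemma cylinder_laplace l n i : 0 <= l ->
  (\int[P]_(x in cylinder n i) (expR (- l * fine (J n x)))%:E = (path_weight l n i)%:E)%E.
Proof.
have mC := measurable_cylinder n i.
have [_ _ _ /(_ n i) path _] := hX.
have {}path : P (cylinder n i) =
  ((i 0%N == x0)%:R * \prod_(0 <= k < n) jump_matrix Q (i k) (i k.+1))%:E := path.
rewrite le_eqVlt => /predU1P[<-|l0].
  under eq_integral do rewrite oppr0 mul0r expR0.
  rewrite integral_cst//= mul1e path; congr EFin; rewrite /path_weight; congr (_ * _).
  by apply: eq_bigr => k _; rewrite addr0 divff ?gt_eqF// mulr1.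
pose t (k : nat) : R := 0.
(* [J n] is the sum of the first [n] holding times only, while the joint law up to state [n]
   involves [n.+1] of them. The surplus indicator, with threshold 0, is almost surely 1. *)
transitivity (\int[P]_(x in cylinder n i) (\prod_(0 <= k < n) laplace_weight l (H k x) *
      \prod_(n <= k < n.+1) ((t k)%:E < H k x)%E%:R)%:E)%E.
  apply: ge0_ae_eq_integral => //.
  - by apply/measurable_EFinP; apply: measurable_funTS; exact: measurable_laplace_jump.
  - apply/measurable_EFinP; apply: measurable_funTS; apply: measurable_funM.
      by apply: measurable_prod => k _; exact: measurable_laplace_weight.
    apply: measurable_prod => k _; apply: measurable_bool_natr.
    by rewrite -[X in measurable X]setTI; exact: emeasurable_fun_o_infty.
  - move=> x _; rewrite lee_fin mulr_ge0//; apply: prodr_ge0 => k _ //.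
    exact: laplace_weight_ge0.
  - apply: filterS ae_jump_time_finite => x Jfin _.
    have [-> Hn] := prod_laplace_weight l n Jfin.
    by rewrite big_nat1 /t Hn mulr1.
transitivity (\int[P]_x (\1_(cylinder n i) x * (\prod_(0 <= k < n) laplace_weight l (H k x) *
      \prod_(n <= k < n.+1) ((t k)%:E < H k x)%E%:R))%:E)%E.
  rewrite integral_mkcond; apply: eq_integral => x _.
  by rewrite patchE indicE; case: (boolP (x \in _)) => _; rewrite ?mul1r ?mul0r.
rewrite joint_laplace// path /= big_nat1 /t mulr0 expR0 mulr1.
congr EFin; rewrite /path_weight -mulrA; congr (_ * _).
by rewrite -big_split.
Qed.

(* For [k = 1] and [m] tending to infinity this increases to [exp (- l * tau)]. *)
Fixpoint first_zero_laplace (l : R) (k m : nat) (x : T) : R :=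
  if Y k x == 0%N then expR (- l * fine (J k x))
  else if m is m'.+1 then first_zero_laplace l k.+1 m' x else 0.

Lemma first_zero_laplaceE l k m x : first_zero_laplace l k m x =
  if Y k x == 0%N then expR (- l * fine (J k x))
  else if m is m'.+1 then first_zero_laplace l k.+1 m' x else 0.
Proof. by case: m. Qed.

Lemma first_zero_laplace_ge0 l k m x : 0 <= first_zero_laplace l k m x.
Proof.
elim: m k => [|m IH] k /=; case: ifP => // _; by rewrite expR_ge0.
Qed.

Lemma first_zero_laplace_le1 l k m x : 0 <= l -> first_zero_laplace l k m x <= 1.
Proof.
move=> l0; elim: m k => [|m IH] k /=; case: ifP => // _;
  by rewrite -expR0 ler_expR mulNr oppr_le0 mulr_ge0// fine_ge0// jump_time_ge0.
Qed.

Lemma measurable_first_zero_laplace l k m : measurable_fun setT (first_zero_laplace l k m).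
Proof.
have mY n : measurable_fun setT (fun x => Y n x == 0%N).
  apply: (measurable_fun_bool true) => /=.
  rewrite setTI (_ : _ @^-1` _ = [set x | Y n x = 0%N]).
    exact: measurable_jump_chain.
  by apply/seteqP; split => x /= /eqP.
by elim: m k => [|m IH] k /=; apply: measurable_fun_ifT.
Qed.

Lemma first_zero_laplace_first l x k m p : (p <= m)%N -> Y (k + p)%N x = 0%N ->
  (forall r, (r < p)%N -> Y (k + r)%N x <> 0%N) ->
  first_zero_laplace l k m x = expR (- l * fine (J (k + p)%N x)).
Proof.
elim: p k m => [|p IH] k m pm Yp Ymin; rewrite first_zero_laplaceE.
  by rewrite addn0 in Yp *; rewrite Yp eqxx.
case: m pm => // m pm.
have := Ymin 0%N (ltn0Sn _); rewrite addn0 => /eqP/negbTE ->.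
rewrite addnS -addSn; apply: IH => //; first by rewrite addSn -addnS.
by move=> r rp; rewrite addSn -addnS; apply: Ymin.
Qed.

Definition extend_path (i : nat -> nat) (k a : nat) : nat -> nat :=
  fun j => if j == k then a else i j.

Lemma path_weight_extend l k i a : path_weight l k.+1 (extend_path i k.+1 a) =
  path_weight l k i * (jump_matrix Q (i k) a * (q (i k) / (q (i k) + l))).
Proof.
rewrite /path_weight big_nat_recr//= mulrA /extend_path eqxx (ltn_eqF (ltn0Sn k)).
rewrite (ltn_eqF (ltnSn k)); congr (_ * _ * _).
apply: eq_big_nat => j /andP[_ jk].
by rewrite (ltn_eqF (leqW jk)) (ltn_eqF (_ : j.+1 < k.+1)%N).
Qed.

Lemma cylinder_extend k i a :
  cylinder k.+1 (extend_path i k.+1 a) = cylinder k i `&` [set x | Y k.+1 x = a].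
Proof.
apply/seteqP; split => x /=.
  move=> h; split; last by have := h k.+1 (leqnn _); rewrite /extend_path eqxx.
  by move=> j jk; have := h j (leqW jk); rewrite /extend_path ltn_eqF.
move=> [h ha] j; rewrite leq_eqVlt => /predU1P[->|jk].
  by rewrite ha /extend_path eqxx.
by rewrite h// /extend_path ltn_eqF.
Qed.

Lemma cylinder_bigcup k i : cylinder k i = \bigcup_a cylinder k.+1 (extend_path i k.+1 a).
Proof.
apply/seteqP; split => x; last by move=> [a _]; rewrite cylinder_extend => -[].
by move=> Cx; exists (Y k.+1 x) => //; rewrite cylinder_extend.
Qed.

Lemma integral_cylinder_step k i (f : T -> \bar R) : measurable_fun setT f ->
  (forall x, (0 <= f x)%E) ->
  (\int[P]_(x in cylinder k i) f x =
   \sum_(a <oo) \int[P]_(x in cylinder k.+1 (extend_path i k.+1 a)) f x)%E.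
Proof.
move=> mf f0; rewrite {1}cylinder_bigcup ge0_integral_bigcup//.
- by move=> a; exact: measurable_cylinder.
- exact: measurable_funTS.
- apply/trivIsetP => a b _ _ ab; apply/seteqP; split => x //=.
  by rewrite !cylinder_extend => -[[_ /= ->] [_ /= /eqP]]; rewrite (negbTE ab).
Qed.

End laplace_of_jump_times.

(** * The Laplace transform of the return time of the birth-death process *)

Section birth_death_return_time.
Context {d : measure_display} {T : measurableType d} {R : realType}.
Variables (P : probability T R) (X : R -> T -> nat) (alpha beta : nat -> R).
Hypothesis alpha_gt0 : forall i, (1 <= i)%N -> 0 < alpha i.
Hypothesis beta_gt0 : forall i, 0 < beta i.
Hypothesis hX : markov_chain P X (bd_Q alpha beta) 0%N.
Hypothesis tau_fin : P [set x | (return_time X 0%N x < +oo)%E] = 1%E.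
Local Notation J := (jump_time X).
Local Notation Y := (jump_chain X).
Local Notation Q := (bd_Q alpha beta).
Local Notation tau := (return_time X 0%N).

Let a0 i : 0 < alpha i.+1. Proof. exact: alpha_gt0. Qed.

Let mX t : 0 <= t -> measurable_fun setT (X t). Proof. by have [+ _ _ _ _] := hX; apply. Qed.
Let X_rc x t : 0 <= t -> \forall s \near t^'+, X s x = X t x.
Proof. by have [_ + _ _ _] := hX; apply. Qed.

Let Q00 : - Q 0%N 0%N = beta 0%N. Proof. by rewrite /bd_Q/= opprK. Qed.

Let QSS i : - Q i.+1 i.+1 = alpha i.+1 + beta i.+1.
Proof. by rewrite /bd_Q ltn_eqF// eqxx opprK. Qed.

Let Q_lt0 i : Q i i < 0.
Proof.
rewrite -oppr_gt0; case: i => [|i]; rewrite ?Q00 ?QSS//.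
by rewrite addr_gt0.
Qed.

Let jump_up i : jump_matrix Q i.+1 i.+2 = beta i.+1 / (alpha i.+1 + beta i.+1).
Proof. by rewrite /jump_matrix ltn_eqF// QSS /bd_Q eqxx. Qed.

Let jump_down i : jump_matrix Q i.+1 i = alpha i.+1 / (alpha i.+1 + beta i.+1).
Proof. by rewrite /jump_matrix gtn_eqF// QSS /bd_Q ltn_eqF// eqxx. Qed.

Let jump_out i a : a != i -> a != i.+2 -> jump_matrix Q i.+1 a = 0.
Proof.
move=> ai ai2; rewrite /jump_matrix; case: eqP => // /eqP ia.
by rewrite /bd_Q (negbTE ai2) eqSS eq_sym (negbTE ai) (negbTE ia) mul0r.
Qed.

Let jump01 : jump_matrix Q 0%N 1%N = 1.
Proof. by rewrite /jump_matrix /= /bd_Q/= opprK divff// gt_eqF. Qed.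

(** Splitting a cylinder by the next state plays the role of the Markov property. From [b.+1] only
    [b] and [b.+2] have positive jump probability, and the holding-time factor changes the
    denominator of these probabilities into the one of [hit_laplace]. *)
Lemma integral_first_zero_laplace l k m i : 0 <= l ->
  (\int[P]_(x in cylinder X k i) (first_zero_laplace X l k m x)%:E =
   (path_weight (bd_Q alpha beta) 0 l k i * hit_laplace alpha beta l m (i k))%:E)%E.
Proof.
move=> l0; elim: m k i => [|m IH] k i; case E : (i k) => [|b].
- rewrite hit_laplace0 mulr1 -(cylinder_laplace hX Q_lt0)//.
  apply: eq_integral => x /set_mem Cx.
  by rewrite first_zero_laplaceE (Cx k (leqnn _)) E eqxx.
- rewrite mulr0; apply: integral0_eq => x Cx.
  by rewrite first_zero_laplaceE (Cx k (leqnn _)) E.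
- rewrite hit_laplace0 mulr1 -(cylinder_laplace hX Q_lt0)//.
  apply: eq_integral => x /set_mem Cx.
  by rewrite first_zero_laplaceE (Cx k (leqnn _)) E eqxx.
transitivity (\int[P]_(x in cylinder X k i) (first_zero_laplace X l k.+1 m x)%:E)%E.
  apply: eq_integral => x /set_mem Cx.
  by rewrite first_zero_laplaceE (Cx k (leqnn _)) E.
rewrite (integral_cylinder_step hX)//; last 2 first.
- by apply/measurable_EFinP; exact: measurable_first_zero_laplace hX _ _ _.
- by move=> x; rewrite lee_fin first_zero_laplace_ge0.
pose t a : \bar R := (path_weight Q 0 l k i * (jump_matrix Q b.+1 a *
  ((alpha b.+1 + beta b.+1) / (alpha b.+1 + beta b.+1 + l))) * hit_laplace alpha beta l m a)%:E.
transitivity (\sum_(a <oo) t a)%E.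
  apply: eq_eseriesr => a _; rewrite IH path_weight_extend E QSS.
  by rewrite /t /extend_path eqxx.
have t0 a : (0 <= t a)%E.
  have := IH k.+1 (extend_path i k.+1 a); rewrite path_weight_extend E QSS.
  rewrite {2}/extend_path eqxx /t => <-.
  by apply: integral_ge0 => x _; rewrite lee_fin first_zero_laplace_ge0.
rewrite (@nneseriesD1 _ _ b.+2)// (@nneseriesD1 _ _ b) ?(ltn_eqF (ltnW (ltnSn _)))//.
rewrite eseries0 ?adde0; last first.
  by move=> a _ /andP[a2 ab]; rewrite /t jump_out// mul0r mulr0 mul0r.
rewrite /t jump_up jump_down -EFinD hit_laplaceS; congr EFin.
have := a0 b; have := beta_gt0 b.+1 => b1 a1.
by field; lra.
Qed.

Let expectation_first_zero_laplace l m : 0 <= l ->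
  (\int[P]_x (first_zero_laplace X l 1 m x)%:E =
   (beta 0%N / (beta 0%N + l) * hit_laplace alpha beta l m 1)%:E)%E.
Proof.
move=> l0.
(* The chain leaves 0 for 1 with certainty, so the path [id], that is 0 followed by 1, carries the
   whole mass. *)
have C1 : P (cylinder X 1 id) = 1%E.
  have [_ _ _ /(_ 1%N id) + _] := hX.
  by rewrite big_nat1 jump01 mulr1 /= => <-.
have := integral_first_zero_laplace 1 m id l0.
rewrite /path_weight big_nat1 jump01 mul1r Q00 /= mul1r => <-.
have mC := measurable_cylinder hX 1 id.
rewrite (@ge0_negligible_integral _ _ _ P setT (~` cylinder X 1 id))//.
- by rewrite setDE setCK setTI.
- exact: measurableC.
- by apply/measurable_EFinP; exact: measurable_first_zero_laplace hX _ _ _.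
- by move=> x _; rewrite lee_fin first_zero_laplace_ge0.
- by have := probability_setC P mC; rewrite C1 subee.
Qed.

Lemma ae_return_time_finite : {ae P, forall x, (tau x < +oo)%E}.
Proof.
have m : measurable [set x | (tau x < +oo)%E].
  by rewrite -[X in measurable X]setTI; apply: emeasurable_fun_infty_o => //; exact: measurable_return_time.
apply: (@negligibleS _ _ _ P (~` [set x | (tau x < +oo)%E])).
  by [].
apply/negligibleP; first exact: measurableC.
by have := probability_setC P m; rewrite tau_fin subee.
Qed.

Lemma measurable_laplace_return_time l : measurable_fun setT (fun x => expR (- l * fine (tau x))).
Proof.
apply: measurableT_comp => //; apply: measurable_funM => //.
by apply: measurableT_comp => //; exact: measurable_return_time.
Qed.

(** Almost every path returns after finitely many jumps, from which point on its truncated weight is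
    constant in [m]; the weights are dominated by 1. *)
Lemma hit_laplace_cvg l : 0 <= l ->
  (beta 0%N / (beta 0%N + l) * hit_laplace alpha beta l m 1)%:E @[m --> \oo] -->
  (\int[P]_x (expR (- l * fine (tau x)))%:E)%E.
Proof.
move=> l0; under eq_cvg do rewrite -expectation_first_zero_laplace//.
have mf n : measurable_fun setT (fun x => (first_zero_laplace X l 1 n x)%:E).
  by apply/measurable_EFinP; exact: measurable_first_zero_laplace hX _ _ _.
have mtau : measurable_fun setT (fun x => (expR (- l * fine (tau x)))%:E).
  by apply/measurable_EFinP; exact: measurable_laplace_return_time.
have cvg : {ae P, forall x, setT x ->
    (first_zero_laplace X l 1 n x)%:E @[n --> \oo] --> (expR (- l * fine (tau x)))%:E}.
  have [_ _ Joo _ _] := hX.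
  have := ae_return_time_finite; have := ae_jump_time_finite hX Q_lt0.
  apply: filterS3 Joo => x Joo Jfin tf _.
  have [p [Yp Ymin]] := return_time_finite Jfin Joo tf.
  apply: cvg_near_cst; exists p => // m /= pm.
  rewrite (return_time_first X_rc Jfin Joo Yp Ymin).
  by rewrite (@first_zero_laplace_first _ _ _ _ _ _ _ _ p).
have i1 : P.-integrable setT (cst 1%E) by exact: finite_measure_integrable_cst.
have bd : {ae P, forall x n, setT x -> (`|(first_zero_laplace X l 1 n x)%:E| <= cst 1 x)%E}.
  apply: aeW => x n _; rewrite /= lee_fin ger0_norm ?first_zero_laplace_ge0//.
  exact: first_zero_laplace_le1.
by have [_ _] := dominated_convergence measurableT mf mtau cvg i1 bd.
Qed.

End birth_death_return_time.

(** * The truncated mean of the return time *)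

Section truncated_return_time.
Context {d : measure_display} {T : measurableType d} {R : realType}.
Variables (P : probability T R) (X : R -> T -> nat) (alpha beta : nat -> R).
Hypothesis alpha_gt0 : forall i, (1 <= i)%N -> 0 < alpha i.
Hypothesis beta_gt0 : forall i, 0 < beta i.
Hypothesis hX : markov_chain P X (bd_Q alpha beta) 0%N.
Hypothesis tau_fin : P [set x | (return_time X 0%N x < +oo)%E] = 1%E.
Local Notation M := (M alpha beta).
Local Notation s := (scale alpha beta).
Local Notation F := (F alpha beta).
Local Notation F_inv := (F_inv alpha beta).
Local Notation tau x := (fine (return_time X 0%N x)).

Let mtau : measurable_fun setT (fun x => tau x).
Proof.
have [mX X_rc _ _ _] := hX.
by apply: measurableT_comp => //; exact: measurable_return_time.
Qed.

Let tau_ge0 x : 0 <= tau x. Proof. by rewrite fine_ge0// return_time_ge0. Qed.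

Let phi l : R := fine (\int[P]_x (expR (- l * tau x))%:E)%E.

Let phiE l : 0 <= l -> (\int[P]_x (expR (- l * tau x))%:E)%E = (phi l)%:E.
Proof.
move=> l0; rewrite /phi fineK// ge0_fin_numE; last first.
  by apply: integral_ge0 => x _; rewrite lee_fin expR_ge0.
apply: (@le_lt_trans _ _ (\int[P]_x (cst 1%:E x))%E); last first.
  by rewrite integral_cst//= probability_setT mul1e ltry.
apply: ge0_le_integral => //.
- by apply/measurable_EFinP; exact: measurable_laplace_return_time hX _.
- by move=> x _; rewrite /= lee_fin -expR0 ler_expR mulNr oppr_le0 mulr_ge0.
Qed.

Let phi_cvg l : 0 <= l ->
  beta 0%N / (beta 0%N + l) * hit_laplace alpha beta l m 1 @[m --> \oo] --> phi l.
Proof.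
move=> l0; have := hit_laplace_cvg alpha_gt0 beta_gt0 hX tau_fin l0.
by rewrite phiE// => /fine_cvgP[_].
Qed.

Let hit0_cvg : hit_laplace alpha beta 0 m 1 @[m --> \oo] --> (1 : R).
Proof.
have := phi_cvg (lexx 0).
rewrite addr0 divff ?gt_eqF// (_ : phi 0 = 1).
  by under eq_cvg do rewrite mul1r.
rewrite /phi; under eq_integral do rewrite oppr0 mul0r expR0.
by rewrite integral_cst//= probability_setT mule1.
Qed.

Let M_ge0 n : 0 <= M n. Proof. exact/ltW/M_gt0. Qed.

Let F_ge0 n : 0 <= F n.
Proof. by apply: mulr_ge0; [exact: M_ge0|exact: scale_ge0]. Qed.

Let phi_upper l n : 0 < l ->
  l / (1 + l * F n) * M n / (beta 0%N + l) <= 1 - phi l.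
Proof.
move=> l0; have b0 := beta_gt0 0%N.
have F0 := F_ge0 n.
set e := l / (1 + l * F n).
(* The holding time at 0 contributes [l / (beta 0 + l)]; since [e <= l], it covers the missing mass
   [m 0 = 1] and turns [M n - 1] into [M n]. *)
have el : e <= l.
  have lF : 0 <= l * F n by rewrite mulr_ge0// ltW.
  by rewrite /e ler_pdivrMr ?ltr_wpDr// ler_peMr ?(ltW l0)// lerDl.
suff h : phi l <= beta 0%N / (beta 0%N + l) * (1 - e * ((M n - 1) / beta 0%N)).
  rewrite lerBrDl -lerBrDr (le_trans h)//.
  have -> : 1 - e * M n / (beta 0%N + l) = (beta 0%N + l - e * M n) / (beta 0%N + l).
    by field; lra.
  have -> : beta 0%N / (beta 0%N + l) * (1 - e * ((M n - 1) / beta 0%N)) =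
     (beta 0%N + e - e * M n) / (beta 0%N + l).
    by field; lra.
  by rewrite ler_pM2r ?invr_gt0; lra.
have cv := phi_cvg (ltW l0); rewrite -(cvg_lim _ cv)//.
apply: limr_le; first by apply/cvg_ex; eexists; exact: cv.
apply: nearW => m; rewrite ler_pM2l ?divr_gt0//; last by lra.
exact: hit_laplace_upper.
Qed.

Let phi_lower l n : 0 < l ->
  1 - phi l <= (l * M n + (s n.+1)^-1) / beta 0%N.
Proof.
move=> l0; have b0 := beta_gt0 0%N; have sn := scale_gt0 alpha_gt0 beta_gt0 n.
set c := 1 - l * ((M n - 1) / beta 0%N) - (beta 0%N * s n.+1)^-1.
have h : beta 0%N / (beta 0%N + l) * c <= phi l.
  (* The defect [1 - hit_laplace 0 m 1] is carried along up to the limit in [m], where recurrence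
     makes it vanish. *)
  have cv : beta 0%N / (beta 0%N + l) * hit_laplace alpha beta l m 1 +
     beta 0%N / (beta 0%N + l) * (1 - hit_laplace alpha beta 0 m 1) @[m --> \oo] -->
     phi l + beta 0%N / (beta 0%N + l) * (1 - 1).
    apply: cvgD; first exact: (phi_cvg (ltW l0)).
    by apply: cvgMr; apply: cvgB => //; exact: cvg_cst.
  rewrite subrr mulr0 addr0 in cv.
  rewrite -(cvg_lim _ cv)//.
  apply: limr_ge; first by apply/cvg_ex; eexists; exact: cv.
  apply: nearW => m; rewrite -mulrDr ler_pM2l ?divr_gt0//; last by lra.
  exact: hit_laplace_lower.
apply: (@le_trans _ _ (1 - beta 0%N / (beta 0%N + l) * c)); first by lra.
have -> : 1 - beta 0%N / (beta 0%N + l) * c = (l * M n + (s n.+1)^-1) / (beta 0%N + l).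
  by rewrite /c; field; rewrite !gt_eqF//; lra.
rewrite ler_wpM2l//; last by rewrite lef_pV2 ?posrE; lra.
by rewrite addr_ge0 ?invr_ge0 ?(ltW sn)// mulr_ge0 ?(ltW l0).
Qed.

(** From [1 + u <= exp u] follows [1 - exp (- u) >= u / (1 + u)], which is at least half of
    [min u 1]. *)
Let min_le_laplace (u : R) : 0 <= u -> Num.min u 1 <= 2 * (1 - expR (- u)).
Proof.
move=> u0; rewrite expRN.
have h := expR_ge1Dx u; have e0 := expR_gt0 u.
have : (expR u)^-1 <= (1 + u)^-1 by rewrite lef_pV2 ?posrE; lra.
have -> : (1 + u)^-1 = 1 - u / (1 + u) by field; lra.
suff : Num.min u 1 <= 2 * (u / (1 + u)) by lra.
rewrite mulrA ler_pdivlMr; last by lra.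
by case: (leP u 1) => u1; nra.
Qed.

Let laplace_le_min (u : R) : 0 <= u -> 1 - expR (- u) <= Num.min u 1.
Proof.
move=> u0; rewrite le_min; have := expR_ge1Dx (- u); have := expR_gt0 (- u).
by move=> ? ?; apply/andP; split; lra.
Qed.

Definition truncated_mean (t : R) : \bar R := (\int[P]_x (Num.min (tau x) t)%:E)%E.

Let truncated_mean_laplace t : 0 < t ->
  ((t * (1 - phi t^-1))%:E <= truncated_mean t <= (2 * (t * (1 - phi t^-1)))%:E)%E.
Proof.
move=> t0; have ti0 : 0 < t^-1 by rewrite invr_gt0.
pose f x : R := 1 - expR (- t^-1 * tau x).
have f0 x : 0 <= f x.
  by rewrite subr_ge0 -expR0 ler_expR mulNr oppr_le0 mulr_ge0// ltW.
have mE : measurable_fun setT (fun x => expR (- t^-1 * tau x)).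
  exact: measurable_laplace_return_time hX _.
have mf : measurable_fun setT f by exact: measurable_funB.
have If : (\int[P]_x (f x)%:E = (1 - phi t^-1)%:E)%E.
  have : (\int[P]_x ((f x)%:E + (expR (- t^-1 * tau x))%:E) = 1)%E.
    under eq_integral do rewrite -EFinD subrK.
    by rewrite integral_cst//= probability_setT mule1.
  rewrite ge0_integralD//; last 3 first.
  - by move=> x _; rewrite lee_fin.
  - exact/measurable_EFinP.
  - exact/measurable_EFinP.
  rewrite phiE ?(ltW ti0)// => E.
  by rewrite EFinB -E addeK.
have mmin : measurable_fun setT (fun x => (Num.min (tau x) t)%:E).
  by apply/measurable_EFinP; exact: measurable_minr.
have minE x : Num.min (tau x) t = t * Num.min (t^-1 * tau x) 1.
  by rewrite minr_pMr ?(ltW t0)// mulr1 mulrA divff ?gt_eqF// mul1r.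
apply/andP; split.
  rewrite EFinM -If -ge0_integralZl//.
  - apply: ge0_le_integral => //.
    + by move=> x _; rewrite mule_ge0// lee_fin// ltW.
    + by apply: measurable_funeM; exact/measurable_EFinP.
    + move=> x _; rewrite -EFinM lee_fin minE ler_pM2l//.
      by rewrite /f mulNr laplace_le_min// mulr_ge0// ltW.
  - exact/measurable_EFinP.
  - by move=> x _; rewrite lee_fin.
  - by rewrite lee_fin ltW.
rewrite mulrA EFinM -If -ge0_integralZl//.
- apply: ge0_le_integral => //.
  + by move=> x _; rewrite lee_fin le_min tau_ge0 ltW.
  + by apply: measurable_funeM; exact/measurable_EFinP.
  + move=> x _; rewrite -EFinM lee_fin minE (mulrC 2) -mulrA ler_pM2l//.
    by rewrite /f mulNr min_le_laplace// mulr_ge0// ltW.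
- exact/measurable_EFinP.
- by move=> x _; rewrite lee_fin.
- by rewrite lee_fin mulr_ge0// ltW.
Qed.

Lemma truncated_mean_ge t n : 0 < t ->
  ((t / (t + F n) * M n / (beta 0%N + t^-1))%:E <= truncated_mean t)%E.
Proof.
move=> t0; have /andP[+ _] := truncated_mean_laplace t0; apply: le_trans.
have ti0 : 0 < t^-1 by rewrite invr_gt0.
have F0 := F_ge0 n.
rewrite lee_fin; have := phi_upper n ti0; rewrite -(ler_pM2l t0); apply: le_trans.
rewrite (_ : t / (t + F n) = t * (t^-1 / (1 + t^-1 * F n))); last by field; lra.
by rewrite !mulrA.
Qed.

Lemma truncated_mean_le t n : 0 < t ->
  (truncated_mean t <= (2 / beta 0%N * (M n + t / s n.+1))%:E)%E.
Proof.
move=> t0; have /andP[_] := truncated_mean_laplace t0; move=> /le_trans; apply.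
have ti0 : 0 < t^-1 by rewrite invr_gt0.
have b0 := beta_gt0 0%N; have sn := scale_gt0 alpha_gt0 beta_gt0 n.
rewrite lee_fin.
apply: (@le_trans _ _ (2 * (t * ((t^-1 * M n + (s n.+1)^-1) / beta 0%N)))).
  by rewrite !ler_pM2l//; exact: phi_lower.
rewrite le_eqVlt; apply/orP; left; apply/eqP; field.
by rewrite !gt_eqF.
Qed.

Lemma F_unbounded t : exists n, t <= F n.
Proof.
have [n sn] := scale_unbounded alpha_gt0 beta_gt0 t hit0_cvg.
exists n; rewrite (le_trans (ltW sn))// /Defs.F ler_peMl//.
  exact: scale_ge0.
exact: M_ge1.
Qed.

Lemma F_inv_spec t : t <= F (F_inv t) /\ forall n, t <= F n -> (F_inv t <= n)%N.
Proof.
rewrite /Defs.F_inv; case: pselect => [h|]; last by have := F_unbounded t.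
by case: ex_minnP.
Qed.

Lemma F_inv_le t u : t <= u -> (F_inv t <= F_inv u)%N.
Proof. by move=> tu; apply: (F_inv_spec t).2; rewrite (le_trans tu)//; exact: (F_inv_spec u).1. Qed.

Lemma F_inv_gt0 t : 0 < t -> exists2 n, F_inv t = n.+1 & F n < t <= F n.+1.
Proof.
move=> t0; have [] := F_inv_spec t; case: (F_inv t) => [|n] tF Fmin.
  by move: tF; rewrite /Defs.F /= mulr0 leNgt t0.
by exists n; rewrite // tF andbT ltNge; apply/negP => /Fmin; rewrite ltnn.
Qed.

End truncated_return_time.

(** A finite limsup bounds a tail, and the absolute values of the finitely many remaining terms are
    added to the bound. A bound valid at every index makes the constants of the ratio conditions
    uniform on [[t0, +oo[]. *)
Lemma limn_esup_lty_bounded {R : realType} (u : nat -> R) :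
  (limn_esup (fun n => (u n)%:E) < +oo)%E -> exists2 C, 0 < C & forall n, u n <= C.
Proof.
rewrite limn_esup_lim => limoo.
have [N hN] : exists N, (esups (fun n => (u n)%:E) N < +oo)%E.
  apply: contrapT => /forallNP h; move: limoo.
  rewrite (_ : esups _ = cst +oo%E); first by rewrite lim_cst.
  by apply/funext => n; apply/eqP; rewrite -leye_eq leNgt; exact/negP.
have uN n : (N <= n)%N -> ((u n)%:E <= esups (fun n => (u n)%:E) N)%E.
  by move=> Nn; apply: ereal_sup_ubound; exists n.
have [B hB] : exists B, forall n, (N <= n)%N -> u n <= B.
  move: hN uN; case: (esups _ N) => [B _ h|//|_ h].
    by exists B => n Nn; rewrite -lee_fin; exact: h.
  by have := h N (leqnn N).
exists (1 + `|B| + \sum_(k < N) `|u k|).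
  by rewrite ltr_wpDr ?sumr_ge0// ltr_wpDr.
move=> n; have [Nn|nN] := leqP N n.
  rewrite (le_trans (hB n Nn))// -addrA addrCA (le_trans (ler_norm B))// lerDl.
  by rewrite addr_ge0// sumr_ge0.
rewrite (bigD1 (Ordinal nN))//= addrCA (le_trans (ler_norm _))// lerDl.
by rewrite !addr_ge0// sumr_ge0.
Qed.

(** * From bounds on the truncated mean to the integral test *)

Section weighted_integral_comparison.
Context {d : measure_display} {T : measurableType d} {R : realType}.
Variables (P : probability T R) (X : R -> T -> nat).
Variables (w : R -> R) (t0 : R).
Hypothesis wC : condition_C w t0.
Hypothesis mtau : measurable_fun setT (return_time X 0%N).
Local Notation w2 := (derive1n 2 w).
Local Notation mu := (@lebesgue_measure R).

Let measurable_truncated_mean (k : R) : 0 <= k ->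
  measurable_fun `[k, +oo[ (truncated_mean P X).
Proof.
move=> k0.
(* Clipping at 0 and taking the real part give a function nondecreasing on the whole line, hence
   measurable. *)
pose h t := fine (truncated_mean P X (Num.max 0 t)).
have mmin t : measurable_fun setT (fun x => (Num.min (fine (return_time X 0%N x)) t)%:E).
  apply/measurable_EFinP; apply: measurable_minr => //.
  exact: measurableT_comp.
have tau0 x : 0 <= fine (return_time X 0%N x) by rewrite fine_ge0// return_time_ge0.
have fin (t : R) : 0 <= t -> truncated_mean P X t \is a fin_num.
  move=> tt0; rewrite ge0_fin_numE; last first.
    by apply: integral_ge0 => x _; rewrite lee_fin le_min tau0.
  apply: (@le_lt_trans _ _ (\int[P]_x (cst t%:E x))%E); last first.
    by rewrite integral_cst//= probability_setT mule1 ltry.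
  apply: ge0_le_integral => //.
  - by move=> x _; rewrite lee_fin le_min tau0.
  - by move=> x _; rewrite /= lee_fin ge_min lexx orbT.
have hmono : nondecreasing_fun h.
  move=> s t st; have m0 u : 0 <= Num.max 0 u :> R by rewrite le_max lexx.
  apply: fine_le; rewrite ?fin//.
  apply: ge0_le_integral => //.
  - by move=> x _; rewrite lee_fin le_min tau0 m0.
  - have mst : Num.max 0 s <= Num.max 0 t by rewrite ge_max m0/= le_max st orbT.
    by move=> x _; rewrite lee_fin le_min ge_min lexx/= ge_min mst orbT.
apply: (eq_measurable_fun (EFin \o h)).
  move=> t; rewrite inE/= in_itv/= andbT => kt.
  by rewrite /h max_r ?(le_trans k0)// fineK// fin// (le_trans k0).
by apply/measurable_EFinP; exact: nondecreasing_measurable.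
Qed.

Lemma condition_C_expectation_comparison (g : R -> R) (c C : R) :
  0 < c -> 0 < C -> measurable_fun `[t0, +oo[ g ->
  (forall t, t0 <= t -> ((c * g t)%:E <= truncated_mean P X t <= (C * g t)%:E)%E) ->
  ('E_P[fun x => w (fine (return_time X 0%N x))] < +oo)%E <->
  integrable_at_infinity t0 (fun t => `|w2 t| * g t).
Proof.
move=> c0 C0 mg bounds; have t00 := condition_C_gt0 wC.
have mtau' : measurable_fun setT (fun x => fine (return_time X 0%N x)) by exact: measurableT_comp.
have tau0 x : 0 <= fine (return_time X 0%N x) by rewrite fine_ge0// return_time_ge0.
have H0 (t : R) : t0 <= t -> (0 <= truncated_mean P X t)%E.
  move=> t0t; apply: integral_ge0 => x _.
  by rewrite lee_fin le_min tau0 (le_trans (ltW t00)).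
have g0 (t : R) : t0 <= t -> 0 <= g t.
  move=> t0t; have /andP[_ h] := bounds t t0t.
  have := le_trans (H0 t t0t) h.
  by rewrite lee_fin pmulr_rge0.
have sub (k : R) : t0 <= k -> forall t, t \in `[k, +oo[%R -> t0 <= t.
  by move=> t0k t; rewrite in_itv/= andbT; exact: le_trans.
have mw (k : R) : t0 <= k -> measurable_fun `[k, +oo[ (fun t => `|w2 t|).
  by move=> t0k; exact: (measurable_abs_derive2_condition_C wC t0k).
have mgk (k : R) : t0 <= k -> measurable_fun `[k, +oo[ g.
  by move=> t0k; apply: measurable_funS mg => // t /= /(sub k t0k); rewrite in_itv/= andbT.
have mwg (k : R) : t0 <= k -> measurable_fun `[k, +oo[ (fun t => (`|w2 t| * g t)%:E).
  by move=> t0k; apply/measurable_EFinP/measurable_funM; [exact: mw|exact: mgk].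
have mwH (k : R) : t0 <= k -> measurable_fun `[k, +oo[ (fun t => `|w2 t|%:E * truncated_mean P X t)%E.
  move=> t0k; apply: emeasurable_funM; first by apply/measurable_EFinP; exact: mw.
  by apply: measurable_truncated_mean; rewrite (le_trans (ltW t00)).
have scal (k a : R) : t0 <= k -> 0 <= a ->
    (\int[mu]_(t in `[k, +oo[) (a%:E * (`|w2 t| * g t)%:E) =
     a%:E * \int[mu]_(t in `[k, +oo[) (`|w2 t| * g t)%:E)%E.
  move=> t0k a0; rewrite ge0_integralZl//; first exact: mwg.
  by move=> t /= /(sub k t0k) tt; rewrite lee_fin mulr_ge0// g0.
split.
- move=> /(condition_C_expectation wC P mtau' tau0 (lexx t0)) fin.
  exists t0 => //.
  suff : (c%:E * \int[mu]_(t in `[t0, +oo[) (`|w2 t| * g t)%:E < +oo)%E.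
    rewrite -[X in (_ < X)%E -> _](@gt0_muley _ c%:E) ?lte_fin//.
    by rewrite lte_pmul2l// lte_fin.
  apply: le_lt_trans fin; rewrite -scal ?(ltW c0)//.
  apply: ge0_le_integral => //.
  + by move=> t /= /(sub t0 (lexx _)) tt; rewrite mule_ge0 ?lee_fin ?(ltW c0)// mulr_ge0// g0.
  + by apply: measurable_funeM; exact: mwg.
  + exact: mwH.
  + move=> t /= /(sub t0 (lexx _)) tt; have /andP[h _] := bounds t tt.
    by rewrite EFinM muleCA; apply: lee_wpmul2l => //; rewrite -EFinM.
- move=> [k t0k fin]; apply/(condition_C_expectation wC P mtau' tau0 t0k).
  apply: (@le_lt_trans _ _ (C%:E * \int[mu]_(t in `[k, +oo[) (`|w2 t| * g t)%:E)%E); last first.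
    by rewrite lte_mul_pinfty// lee_fin ltW.
  rewrite -scal ?(ltW C0)//.
  apply: ge0_le_integral => //.
  + by move=> t /= /(sub k t0k) tt; rewrite mule_ge0// H0.
  + exact: mwH.
  + by apply: measurable_funeM; exact: mwg.
  + move=> t /= /(sub k t0k) tt; have /andP[_ h] := bounds t tt.
    by rewrite EFinM muleCA; apply: lee_wpmul2l => //; rewrite -EFinM.
Qed.

End weighted_integral_comparison.

Theorem theorem5p1 (R : realType) (d : measure_display) (T : measurableType d)
    (P : probability T R) (X : R -> T -> nat) (alpha beta : nat -> R)
    (alpha_gt0 : forall i : nat, (1 <= i)%N -> 0 < alpha i)
    (beta_gt0 : forall i : nat, 0 < beta i)
    (X_bd : markov_chain P X (bd_Q alpha beta) 0%N)
    (X_null : null_recurrent P X)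
    (w : R -> R) (t0 : R) (w_C : condition_C w t0) :
  let tau := return_time X 0%N in
  ((limn_esup (fun n : nat => (M alpha beta n / M alpha beta n.-1)%:E) < +oo)%E ->
   (('E_P[fun x => w (fine (tau x))] < +oo)%E <->
    integrable_at_infinity t0
      (fun t => `|w^`(2) t| * M alpha beta (F_inv alpha beta t))))
  /\
  ((limn_esup (fun n : nat => (scale alpha beta n / scale alpha beta n.-1)%:E)
      < +oo)%E ->
   (('E_P[fun x => w (fine (tau x))] < +oo)%E <->
    integrable_at_infinity t0
      (fun t => t * `|w^`(2) t| / scale alpha beta (F_inv alpha beta t)))).
Proof.
move=> tau; have t00 := condition_C_gt0 w_C.
have [tau_fin _] := X_null.
have [mX X_rc _ _ _] := X_bd.
have mtau : measurable_fun setT tau by exact: measurable_return_time.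
have b0 := beta_gt0 0%N.
have inv_le t : t0 <= t -> beta 0%N + t^-1 <= beta 0%N + t0^-1.
  by move=> t0t; rewrite lerD2l lef_pV2 ?posrE// (lt_le_trans t00).
pose B := beta 0%N + t0^-1; have B0 : 0 < B by rewrite addr_gt0// invr_gt0.
have M0 n : 0 < M alpha beta n by exact: M_gt0.
have s0 n : 0 < scale alpha beta n.+1 by exact: scale_gt0.
have F0 n : 0 <= F alpha beta n.
  by apply: mulr_ge0; [exact/ltW/M0|exact: scale_ge0].
(* [E (min tau t)] is comparable to [M n + t / s n.+1] when [F n < t <= F n.+1] *)
have H_ge t n : t0 <= t ->
    ((t / (t + F alpha beta n) * M alpha beta n / B)%:E <= truncated_mean P X t)%E.
  move=> t0t; have tt := lt_le_trans t00 t0t.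
  apply: le_trans (truncated_mean_ge alpha_gt0 beta_gt0 X_bd tau_fin n tt).
  rewrite lee_fin ler_wpM2l ?lef_pV2 ?posrE ?inv_le//.
    by rewrite mulr_ge0 ?(ltW (M0 n))// divr_ge0 ?(ltW tt)// addr_ge0// ltW.
  by rewrite addr_gt0// invr_gt0.
have H_le t n : t0 <= t -> (truncated_mean P X t <=
    (2 / beta 0%N * (M alpha beta n + t / scale alpha beta n.+1))%:E)%E.
  move=> t0t; exact: (truncated_mean_le alpha_gt0 beta_gt0 X_bd tau_fin n (lt_le_trans t00 t0t)).
have inv_spec t : t0 <= t -> exists2 n, F_inv alpha beta t = n.+1 &
    F alpha beta n < t <= F alpha beta n.+1.
  by move=> t0t; apply: (F_inv_gt0 alpha_gt0 beta_gt0 X_bd tau_fin); exact: lt_le_trans t0t.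
have inv_mono : {homo F_inv alpha beta : s t / s <= t >-> (s <= t)%N}.
  by move=> s t; exact: (F_inv_le alpha_gt0 beta_gt0 X_bd tau_fin).
split.
- move=> /limn_esup_lty_bounded[C C0 MC].
  have {}MC n : M alpha beta n.+1 <= C * M alpha beta n.
    by rewrite -ler_pdivrMr//; exact: (MC n.+1).
  (* With [F n < t <= F n.+1]: below, [t / (t + F n) >= 1 / 2] and the ratio condition replaces
     [M n] by [M n.+1 / C]; above, [t / s n.+1 <= M n.+1], so the sum is at most [2 * M n.+1]. *)
  apply: (@condition_C_expectation_comparison _ _ _ P X w t0 w_C mtau
    (fun t => M alpha beta (F_inv alpha beta t)) (2 * B * C)^-1 (4 / beta 0%N)).
  + by rewrite invr_gt0 !mulr_gt0.
  + by rewrite divr_gt0.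
  + by apply: nondecreasing_measurable => // s t st; apply: M_le => //; exact: inv_mono.
  move=> t t0t; have [n -> /andP[Fn Ft]] := inv_spec t t0t.
  have tt := lt_le_trans t00 t0t.
  have Fn0 := F0 n.
  apply/andP; split.
    apply: le_trans (H_ge t n t0t); rewrite lee_fin.
    apply: (@le_trans _ _ (2^-1 * M alpha beta n / B)).
      have -> : 2^-1 * M alpha beta n / B = (2 * B * C)^-1 * (C * M alpha beta n).
        by field; lra.
      by rewrite ler_pM2l// invr_gt0 !mulr_gt0.
    by rewrite ler_pM2r ?invr_gt0// ler_pM2r// ler_pdivlMr; lra.
  apply: (le_trans (H_le t n t0t)); rewrite lee_fin.
  have h1 : t / scale alpha beta n.+1 <= M alpha beta n.+1 by rewrite ler_pdivrMr.
  have h2 : M alpha beta n <= M alpha beta n.+1 by apply: M_le.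
  have -> : 4 / beta 0%N * M alpha beta n.+1 = 2 / beta 0%N * (2 * M alpha beta n.+1).
    by field; lra.
  by rewrite ler_pM2l ?divr_gt0//; lra.
- move=> /limn_esup_lty_bounded[C C0 sC].
  (* The quotient at index 1 has denominator [scale 0 = 0] and says nothing, so the ratio bound
     starts from [scale 1]. *)
  have {}sC n : scale alpha beta n.+2 <= C * scale alpha beta n.+1.
    by rewrite -ler_pdivrMr//; exact: (sC n.+2).
  pose s1 := scale alpha beta 1; have s10 : 0 < s1 := s0 0%N.
  (* [D] is chosen so that [M n <= D * (t / s n.+1)]. For positive [n],
     [M n * s n.+1 <= C * F n < C * t]; for [n = 0] the summand [s1 / t0] suffices because [M 0 = 1]
     and [t >= t0]. *)
  pose D := C + s1 / t0; have D0 : 0 < D by rewrite addr_gt0// divr_gt0.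
  rewrite (_ : (fun t => t * `|derive1n 2 w t| / scale alpha beta (F_inv alpha beta t)) =
    (fun t => `|derive1n 2 w t| * (t / scale alpha beta (F_inv alpha beta t)))); last first.
    by apply/funext => t; rewrite mulrAC mulrC.
  apply: (@condition_C_expectation_comparison _ _ _ P X w t0 w_C mtau
    (fun t => t / scale alpha beta (F_inv alpha beta t)) (2 * B)^-1 (2 / beta 0%N * (1 + D))).
  + by rewrite invr_gt0 mulr_gt0.
  + by rewrite mulr_gt0 ?divr_gt0// addr_gt0.
  (* For [t <= 0] one has [F_inv t = 0], and the inverse of [scale 0 = 0] is 0 by convention, which
     breaks monotonicity. Clipping at [t0] restores it. *)
  + apply: (@eq_measurable_fun _ _ _ _ _ (fun t : R => t * (scale alpha beta (F_inv alpha beta (Num.max t0 t)))^-1)).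
      by move=> t; rewrite inE/= in_itv/= andbT => t0t; rewrite max_r.
    apply: measurable_funM => //; apply: nonincreasing_measurable => // u v uv.
    have t0m (x : R) : t0 <= Num.max t0 x by rewrite le_max lexx.
    have muv : Num.max t0 u <= Num.max t0 v by rewrite ge_max t0m/= le_max uv orbT.
    have := inv_mono _ _ muv.
    have [n -> _] := inv_spec _ (t0m u); have [m -> _] := inv_spec _ (t0m v) => nm.
    by rewrite lef_pV2 ?posrE//; apply: scale_le.
  move=> t t0t; have [n -> /andP[Fn Ft]] := inv_spec t t0t.
  have tt := lt_le_trans t00 t0t.
  have sn := s0 n; have Mn := M0 n.+1.
  apply/andP; split.
    (* The bound is used at [n.+1], where [t <= F n.+1] gives
       [t / (t + F n.+1) >= t / (2 * F n.+1)]; then [M n.+1] cancels in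
       [F n.+1 = M n.+1 * s n.+1]. *)
    apply: le_trans (H_ge t n.+1 t0t); rewrite lee_fin.
    have FE : F alpha beta n.+1 = M alpha beta n.+1 * scale alpha beta n.+1 by [].
    have Fn1 : 0 < F alpha beta n.+1 by rewrite FE mulr_gt0.
    have -> : (2 * B)^-1 * (t / scale alpha beta n.+1) =
        t / (2 * F alpha beta n.+1) * M alpha beta n.+1 / B.
      by rewrite FE; field; lra.
    rewrite ler_pM2r ?invr_gt0// ler_pM2r// ler_pM2l// lef_pV2 ?posrE; lra.
  apply: (le_trans (H_le t n t0t)); rewrite lee_fin -[leRHS]mulrA.
  rewrite ler_pM2l ?divr_gt0// mulrDl mul1r addrC lerD2l.
  rewrite mulrA ler_pdivlMr//.
  case: n Fn Ft sn Mn => [|n] Fn Ft sn Mn.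
    rewrite (M_zero alpha beta) mul1r /D mulrDl -/s1.
    rewrite -mulrA ler_wpDl ?mulr_ge0 ?(ltW C0) ?(ltW tt)//.
    by rewrite ler_peMr ?(ltW s10)// mulrC ler_pdivlMr// mul1r.
  apply: (@le_trans _ _ (C * F alpha beta n.+1)).
    by rewrite /F mulrCA ler_pM2l.
  apply: (@le_trans _ _ (C * t)); first by rewrite ler_pM2l// ltW.
  by rewrite /D mulrDl lerDl mulr_ge0 ?(ltW tt)// divr_ge0 ?(ltW s10)// ltW.
Qed.
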